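(* Let $n\ge 2$ and let $X$ be a finite simplicial complex with a free simplicial $S_n$-action. Let $G\coloneqq K_n\times_{S_n}\bigl(\mathrm{Chain}^3(FX)\bigr)^1$. Then $G$ is a loopless graph, and there is an $S_n$-homotopy equivalence \[\bigl|\mathrm{Hom}(K_n, G)\bigr|\simeq_{S_n}|X|,\] where $S_n$ acts on $\mathrm{Hom}(K_n,G)$ via $S_n\cong\mathrm{Aut}(K_n)$ (precomposition) and on $|X|$ by the given action.
   Context: Graphs are finite, undirected, without multiple edges, loops allowed. $K_n$ is the loopless graph on $\{1,\dots,n\}$ with all edges between distinct vertices; $S_n$ acts on it by permuting vertices, regarded as a right action $v\cdot\gamma=\gamma^{-1}(v)$. $\mathrm{Hom}(T,G)$ is the poset of maps $\alpha\colon V(T)\to 2^{V(G)}\setminus\{\emptyset\}$ such that whenever $t\sim t'$ in $T$, every element of $\alpha(t)$ is adjacent to every element of $\alpha(t')$, ordered by pointwise inclusion; $|Q|$ is the geometric realization of the order complex of a poset $Q$. $FX$ is the face poset of $X$. For a poset $P$, $\mathrm{Chain}(P)$ is the poset of nonempty chains of $P$ ordered by inclusion, and $\mathrm{Chain}^3=\mathrm{Chain}\circ\mathrm{Chain}\circ\mathrm{Chain}$; the $S_n$-action on $X$ induces actions on these posets. For a poset $P$, $P^1$ is the reflexive graph on the atoms of $P$, with $x\sim y$ iff some $z\in P$ satisfies $z\ge x,y$. For a graph $T$ with right and a graph $H$ with left $\Gamma$-action, $T\times_\Gamma H$ is the graph on classes of $V(T)\times V(H)$ under $(t\gamma,h)\sim(t,\gamma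 h)$, with $[(t,h)]\sim[(t',h')]$ iff some representatives are adjacent in $T\times H$ (the categorical product). $\simeq_{S_n}$ denotes an $S_n$-equivariant homotopy equivalence. *)

(* Defs.v *)
From HB Require Import structures.
From mathcomp Require Import all_boot all_order all_algebra all_fingroup.

Set Implicit Arguments.
Unset Strict Implicit.
Unset Printing Implicit Defensive.

Import Order.TTheory GRing.Theory Num.Theory.

(* Group actions.  MathComp composes permutations from left to right,
   (s * t) x = t (s x), so an {action 'S_n &-> T}, which satisfies
   to x (s * t) = to (to x s) t, is a left action of the symmetric group with
   its usual composition: to x g stands for "g . x". *)

Record graph := Graph {
  vertex :> finType;
  adj : rel vertex;
  adj_sym : symmetric adj
}.

Definition loopless (G : graph) := forall v : G, ~~ adj v v.

Lemma complete_adj_sym n : symmetric (fun i j : 'I_n => i != j).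
Proof. by move=> i j; rewrite eq_sym. Qed.

Definition complete_graph n : graph := Graph (@complete_adj_sym n).

Definition complete_ract n (v : 'I_n) (g : 'S_n) : 'I_n := (g^-1)%g v.

Section BalancedProduct.
Variables (Gamma : finType) (T H : graph).
(* tr t g is "t g", lh h g is "g h" *)
Variables (tr : T -> Gamma -> T) (lh : H -> Gamma -> H).

Definition balanced_step : rel (T * H) := fun p q =>
  [exists t : T, exists h : H, exists g : Gamma,
     (p == (tr t g, h)) && (q == (t, lh h g))].

Definition balanced_equiv : rel (T * H) :=
  connect (fun p q => balanced_step p q || balanced_step q p).

Definition balanced_class (p : T * H) : {set T * H} :=
  [set q | balanced_equiv p q].

Record balanced_vertex := BalancedVertex {
  bvset :> {set T * H};
  _ : bvset \in [set balanced_class p | p in [set: T * H]]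
}.

HB.instance Definition _ := [isSub for bvset].
HB.instance Definition _ := [Finite of balanced_vertex by <:].

Definition balanced_adj (B C : balanced_vertex) :=
  [exists p in bvset B, exists q in bvset C, adj p.1 q.1 && adj p.2 q.2].

Lemma balanced_adj_sym : symmetric balanced_adj.
Proof.
move=> B C; apply/idP/idP => /exists_inP[p pB /exists_inP[q qC pq]];
  apply/exists_inP; exists q => //; apply/exists_inP; exists p => //;
  by rewrite adj_sym [adj q.2 _]adj_sym.
Qed.

Definition balanced_product : graph := Graph balanced_adj_sym.

End BalancedProduct.

Record complex (V : finType) := Complex {
  simplices : {set {set V}};
  simplex_neq0 : set0 \notin simplices;
  simplex_sub : forall s t : {set V},
    s \in simplices -> t \subset s -> t != set0 -> t \in simplices;
  simplex_vertex : forall v : V, [set v] \in simplices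
}.

Record simplicial_action (gT : finGroupType) (V : finType) (X : complex V) :=
  SimplicialAction {
    vertex_action :> {action gT &-> V};
    simplicial_actP : forall (g : gT) (s : {set V}),
      s \in simplices X -> [set vertex_action v g | v in s] \in simplices X
  }.

Fact face_display : Order.disp_t. Proof. exact: (Order.Disp tt tt). Qed.

Section FacePoset.
Variables (V : finType) (X : complex V).

Record face := Face {
  fset_of :> {set V};
  face_simplex : fset_of \in simplices X
}.

HB.instance Definition _ := [isSub for fset_of].
HB.instance Definition _ := [Finite of face by <:].

Definition face_le (s t : face) := fset_of s \subset fset_of t.

Fact face_le_refl : reflexive face_le.
Proof. by move=> s; exact: subxx. Qed.

Fact face_le_anti : antisymmetric face_le.
Proof. by move=> s t st; apply: val_inj; apply/eqP; rewrite eqEsubset. Qed.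

Fact face_le_trans : transitive face_le.
Proof. by move=> t s u; exact: subset_trans. Qed.

HB.instance Definition _ := Order.Le_isPOrder.Build face_display face
  face_le_refl face_le_anti face_le_trans.

End FacePoset.

(* Order-preserving actions; since gT is a group, each g then acts by an
   automorphism of the poset. *)
Record poset_action (gT : finGroupType) d (P : finPOrderType d) :=
  PosetAction {
    poset_act :> {action gT &-> P};
    poset_actP : forall g : gT, {homo poset_act^~ g : x y / (x <= y)%O}
  }.

Section FaceAction.
Variables (gT : finGroupType) (V : finType) (X : complex V).
Variable a : simplicial_action gT X.

Definition face_act_fun (s : face X) (g : gT) : face X :=
  Face (simplicial_actP a g (face_simplex s)).

Fact face_act1 : face_act_fun^~ 1%g =1 id.
Proof.
move=> s; apply: val_inj => /=.
by rewrite (eq_imset _ (act1 a)) imset_id.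
Qed.

Fact face_actM s : act_morph face_act_fun s.
Proof.
move=> g h; apply: val_inj => /=; rewrite -imset_comp.
by apply: eq_imset => v /=; rewrite actM.
Qed.

Fact face_act_homo g :
  {homo (TotalAction face_act1 face_actM)^~ g : x y / (x <= y)%O}.
Proof. by move=> s t st; exact: imsetS. Qed.

Definition face_action : poset_action gT (face X) :=
  PosetAction face_act_homo.

End FaceAction.

Section OrderComplex.
Variables (d : Order.disp_t) (P : finPOrderType d).

Definition is_chain (c : {set P}) :=
  [forall x in c, forall y in c, (x >=< y)%O].

Definition chains : {set {set P}} := [set c | (c != set0) && is_chain c].

Fact chains_neq0 : set0 \notin chains.
Proof. by rewrite inE eqxx. Qed.

Fact chains_sub (s t : {set P}) :
  s \in chains -> t \subset s -> t != set0 -> t \in chains.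
Proof.
rewrite !inE => /andP[_ sc] /subsetP ts -> /=.
apply/forall_inP => x /ts xs; apply/forall_inP => y /ts ys.
by move/forall_inP: sc => /(_ x xs) /forall_inP; apply.
Qed.

Fact chains_vertex (x : P) : [set x] \in chains.
Proof.
rewrite inE; apply/andP; split.
  by apply/set0Pn; exists x; rewrite inE.
apply/forall_inP => y /set1P->; apply/forall_inP => z /set1P->.
exact: comparablexx.
Qed.

Definition order_complex : complex P :=
  Complex chains_neq0 chains_sub chains_vertex.

Variables (gT : finGroupType) (a : poset_action gT P).

Fact order_complex_actP (g : gT) (s : {set P}) :
  s \in chains -> [set a x g | x in s] \in chains.
Proof.
rewrite !inE => /andP[/set0Pn[x0 x0s] sc]; apply/andP; split.
  by apply/set0Pn; exists (a x0 g); exact: imset_f.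
apply/forall_inP => _ /imsetP[x xs ->]; apply/forall_inP => _ /imsetP[y ys ->].
move/forall_inP: sc => /(_ x xs) /forall_inP/(_ y ys).
by case/orP => xy; apply/orP; [left|right]; exact: poset_actP.
Qed.

Definition order_complex_action : simplicial_action gT order_complex :=
  @SimplicialAction gT P order_complex a order_complex_actP.

End OrderComplex.

(* the nonempty chains of P ordered by inclusion *)
Definition Chain d (P : finPOrderType d) := face (order_complex P).

Definition chain_action d (P : finPOrderType d) (gT : finGroupType)
    (a : poset_action gT P) : poset_action gT (Chain P) :=
  face_action (order_complex_action a).

(* P has no adjoined bottom, so its atoms are its minimal elements; the graph
   P^1 on them is reflexive, z := x witnessing x ~ x. *)
Section AtomGraph.
Variables (d : Order.disp_t) (P : finPOrderType d).

Record atom := Atom {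
  atom_val :> P;
  atom_min : [forall y : P, (y <= atom_val)%O ==> (y == atom_val)]
}.

HB.instance Definition _ := [isSub for atom_val].
HB.instance Definition _ := [Finite of atom by <:].

Definition atom_adj (x y : atom) :=
  [exists z : P, (atom_val x <= z)%O && (atom_val y <= z)%O].

Fact atom_adj_sym : symmetric atom_adj.
Proof. by move=> x y; apply: eq_existsb => z; rewrite andbC. Qed.

Definition atom_graph : graph := Graph atom_adj_sym.

Variables (gT : finGroupType) (a : poset_action gT P).

Fact atom_act_subproof (x : atom) (g : gT) :
  [forall y : P, (y <= a x g)%O ==> (y == a x g)].
Proof.
apply/forallP => y; apply/implyP => /(poset_actP a g^-1%g).
rewrite actK => ygx; have /forallP/(_ (a y g^-1%g)) := atom_min x.
by rewrite ygx /= => /eqP <-; rewrite actKV.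
Qed.

Definition atom_act_fun (x : atom_graph) (g : gT) : atom_graph :=
  Atom (atom_act_subproof x g).

Fact atom_act1 : atom_act_fun^~ 1%g =1 id.
Proof. by move=> x; apply: val_inj; exact: act1. Qed.

Fact atom_actM x : act_morph atom_act_fun x.
Proof. by move=> g h; apply: val_inj; exact: actM. Qed.

Definition atom_action : {action gT &-> atom_graph} :=
  TotalAction atom_act1 atom_actM.

End AtomGraph.

Fact hom_display : Order.disp_t. Proof. exact: (Order.Disp tt tt). Qed.

Section Hom.
Variables T G : graph.

Definition is_multihom (al : {ffun T -> {set G}}) :=
  [forall t, al t != set0] &&
  [forall t, forall t', adj t t' ==>
     [forall x in al t, forall y in al t', adj x y]].

Record Hom := MkHom {
  hom_val :> {ffun T -> {set G}};
  hom_multihom : is_multihom hom_val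
}.

HB.instance Definition _ := [isSub for hom_val].
HB.instance Definition _ := [Finite of Hom by <:].

Definition hom_le (al be : Hom) :=
  [forall t, hom_val al t \subset hom_val be t].

Fact hom_le_refl : reflexive hom_le.
Proof. by move=> al; apply/forallP => t; exact: subxx. Qed.

Fact hom_le_anti : antisymmetric hom_le.
Proof.
move=> al be /andP[/forallP ab /forallP ba]; apply: val_inj; apply/ffunP => t.
by apply/eqP; rewrite eqEsubset ab ba.
Qed.

Fact hom_le_trans : transitive hom_le.
Proof.
move=> be al ga /forallP ab /forallP bc; apply/forallP => t.
exact: subset_trans (ab t) (bc t).
Qed.

HB.instance Definition _ := Order.Le_isPOrder.Build hom_display Hom
  hom_le_refl hom_le_anti hom_le_trans.

End Hom.

(* The action of S_n on Hom(K_n, G) by precomposition,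
   (g . al)(v) = al (v . g) = al (g^-1 (v)). *)
Section HomAction.
Variables (n : nat) (G : graph).
Local Notation HomKn := (Hom (complete_graph n) G).

Fact hom_act_subproof (al : HomKn) (g : 'S_n) :
  is_multihom (T := complete_graph n)
    [ffun v => hom_val al (complete_ract v g)].
Proof.
have /andP[/forallP al0 /forallP aladj] := hom_multihom al.
apply/andP; split; first by apply/forallP => t; rewrite ffunE.
apply/forallP => t; apply/forallP => t'; apply/implyP => tt'; rewrite !ffunE.
have /forallP/(_ (complete_ract t' g))/implyP := aladj (complete_ract t g).
by apply; rewrite /adj /= /complete_ract (inj_eq perm_inj).
Qed.

Definition hom_act_fun (al : HomKn) (g : 'S_n) : HomKn :=
  MkHom (hom_act_subproof al g).

Fact hom_act1 : hom_act_fun^~ 1%g =1 id.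
Proof.
move=> al; apply: val_inj; apply/ffunP => v /=.
by rewrite ffunE /complete_ract invg1 perm1.
Qed.

Fact hom_actM al : act_morph hom_act_fun al.
Proof.
move=> g h; apply: val_inj; apply/ffunP => v /=.
by rewrite !ffunE /complete_ract invMg permM.
Qed.

Fact hom_act_homo g :
  {homo (TotalAction hom_act1 hom_actM)^~ g : x y / (x <= y)%O}.
Proof.
move=> al be /forallP ab; apply/forallP => v /=; rewrite !ffunE; exact: ab.
Qed.

Definition hom_action : poset_action 'S_n HomKn := PosetAction hom_act_homo.

End HomAction.

From mathcomp Require Import boolp classical_sets reals topology normedtype.
From mathcomp Require Import function_spaces.
Import numFieldNormedType.Exports.

Section Realization.
Local Open Scope ring_scope.
Variables (R : realType) (V : finType) (X : complex V).

(* barycentric coordinates, as a subspace of R^V *)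
Definition realization_set : set {ptws V -> R} :=
  fun x => [/\ forall v, 0 <= x v, \sum_(v : V) x v = 1 &
               [set v | x v != 0]%SET \in simplices X].

Definition realization : topologicalType := set_type realization_set.

Variables (gT : finGroupType) (a : simplicial_action gT X).

(* the point sum_v x_v v is sent to sum_v x_v (g . v) *)
Definition push_point (x : V -> R) (g : gT) : {ptws V -> R} :=
  fun v => x (a v g^-1%g).

Fact push_point_subproof (x : realization) (g : gT) :
  push_point (val x) g \in realization_set.
Proof.
have /set_mem[x0 x1 xX] := valP x; apply/mem_set; split.
- by move=> v; exact: x0.
- by rewrite -[RHS]x1 [RHS](reindex_inj (act_inj a g^-1%g)).
- suff -> : [set v | push_point (val x) g v != 0]%SET =
      [set a v g | v in [set v | val x v != 0]]%SET by exact: simplicial_actP.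
  apply/setP => v; rewrite inE; apply/idP/imsetP => [xv|[w]].
    by exists (a v g^-1%g); rewrite ?inE ?actKV.
  by rewrite inE /push_point => xw ->; rewrite actK.
Qed.

Definition realization_act_fun (x : realization) (g : gT) : realization :=
  exist _ (push_point (val x) g) (push_point_subproof x g).

Fact realization_act1 : realization_act_fun^~ 1%g =1 id.
Proof.
by move=> x; apply: val_inj; apply: funext => v; rewrite /= /push_point invg1 act1.
Qed.

Fact realization_actM x : act_morph realization_act_fun x.
Proof.
move=> g h; apply: val_inj; apply: funext => v.
by rewrite /= /push_point /= /push_point invMg actM.
Qed.

Definition realization_action : {action gT &-> realization} :=
  TotalAction realization_act1 realization_actM.

End Realization.

Definition free_action (gT : finGroupType) (T : Type)
    (to : {action gT &-> T}) :=
  forall (x : T) (g : gT), to x g = x -> g = 1%g.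

Section EquivariantHomotopy.
Local Open Scope ring_scope.
Local Open Scope classical_set_scope.
Variables (R : realType) (gT : finGroupType).

Definition equivariant (A B : Type) (a : {action gT &-> A})
    (b : {action gT &-> B}) (f : A -> B) :=
  forall x g, f (a x g) = b (f x) g.

(* only the values H (t, x) with t in [0, 1] matter *)
Definition equivariant_homotopic (A B : topologicalType)
    (a : {action gT &-> A}) (b : {action gT &-> B}) (f0 f1 : A -> B) :=
  exists H : R * A -> B,
    [/\ {within `[0, 1] `*` [set: A], continuous H},
        forall x, H (0, x) = f0 x,
        forall x, H (1, x) = f1 x &
        forall t, 0 <= t <= 1 -> equivariant a b (fun x => H (t, x))].

Definition equivariant_homotopy_equiv (A B : topologicalType)
    (a : {action gT &-> A}) (b : {action gT &-> B}) :=
  exists (f : A -> B) (g : B -> A),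
    [/\ continuous f /\ equivariant a b f,
        continuous g /\ equivariant b a g,
        equivariant_homotopic a a (g \o f) id &
        equivariant_homotopic b b (f \o g) id].

End EquivariantHomotopy.

(* Main.v *)
(** Two barycentric subdivisions make short closed walks rigid: in
    P = Chain^2(FX), comparabilities p1 ~ p2 ~ p3 ~ p4 ~ p1 g force g = 1.  So the
    complete multipartite subgraphs of G that make up a point of Hom(K_n, G) lift
    to K_n x P^1, the lift being unique once its i-th colour is i; hence
    Hom(K_n, G) is isomorphic to the poset M of n-tuples be of nonempty subsets of
    P in which elements of different colours are comparable, S_n acting on the
    colours and on P at once.

    As P = Chain(Q), two comparable x, y : P have x :|: y = max x y, and the
    intersection [core be] of these unions over all x, y of different colours is
    again in P.  It is antitone in be and comparable to every element of be.
    Together with the constant tuples Chain(P) -> M this gives |M| = |P| up to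
    homotopy: a chain D of chains of M is sent by three antitone maps to
    min (max D), to the constant tuple at core (min D), and to their join, and
    antitone maps that are pointwise comparable are homotopic.  Finally |P| is
    equivalent to |X| by barycentric subdivision.  All homotopies are composed
    of affine ones between equivariant maps, hence equivariant. *)

From mathcomp Require Import all_boot all_order all_algebra all_fingroup.
From mathcomp Require Import boolp classical_sets reals topology normedtype.
From mathcomp Require Import function_spaces.
From mathcomp Require Import fintype finset ring lra.
(* After all_algebra, whose Hom would shadow the one of Defs. *)
Require Import Defs.

Set Implicit Arguments.
Unset Strict Implicit.
Unset Printing Implicit Defensive.

Import Order.TTheory GRing.Theory Num.Theory.
Import numFieldNormedType.Exports.

Local Open Scope ring_scope.

(** * Geometric realizations and equivariant homotopies *)

Lemma continuous_compose (A B C : topologicalType) (f : A -> B) (g : B -> C) :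
  continuous f -> continuous g -> continuous (fun x => g (f x)).
Proof. by move=> fc gc x; apply: continuous_comp; [exact: fc|exact: gc]. Qed.

Lemma continuous_pair (A B C : topologicalType) (f : A -> B) (g : A -> C) :
  continuous f -> continuous g -> continuous (fun x => (f x, g x)).
Proof. by move=> fc gc x; apply: cvg_pair; [exact: fc|exact: gc]. Qed.

Lemma continuous_fst (A B : topologicalType) : continuous (@fst A B).
Proof. by move=> x; exact: cvg_fst. Qed.

Lemma continuous_snd (A B : topologicalType) : continuous (@snd A B).
Proof. by move=> x; exact: cvg_snd. Qed.

Section RealContinuity.
Variables (R : realType) (A : topologicalType).
Implicit Types f g : A -> R.

Lemma continuous_add f g :
  continuous f -> continuous g -> continuous (fun x => f x + g x).
Proof. by move=> fc gc x; apply: cvgD; [exact: fc|exact: gc]. Qed.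

Lemma continuous_sub f g :
  continuous f -> continuous g -> continuous (fun x => f x - g x).
Proof. by move=> fc gc x; apply: cvgB; [exact: fc|exact: gc]. Qed.

Lemma continuous_mul f g :
  continuous f -> continuous g -> continuous (fun x => f x * g x).
Proof. by move=> fc gc x; apply: cvgM; [exact: fc|exact: gc]. Qed.

Lemma continuous_inv f :
  (forall x, f x != 0) -> continuous f -> continuous (fun x => (f x)^-1).
Proof. by move=> f0 fc x; apply: cvgV; [exact: f0|exact: fc]. Qed.

Lemma continuous_abs f : continuous f -> continuous (fun x => `|f x|).
Proof. by move=> fc x; apply: cvg_norm; exact: fc. Qed.

Lemma continuous_maxr f g :
  continuous f -> continuous g -> continuous (fun x => Num.max (f x) (g x)).
Proof. by move=> fc gc x; exact: (continuous_max (fc x) (gc x)). Qed.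

Lemma continuous_sum (I : finType) (P : pred I) (F : I -> A -> R) :
  (forall i, P i -> continuous (F i)) ->
  continuous (fun x => \sum_(i | P i) F i x).
Proof. apply: continuous_big; exact: add_continuous. Qed.

Lemma continuous_prod (I : finType) (P : pred I) (F : I -> A -> R) :
  (forall i, P i -> continuous (F i)) ->
  continuous (fun x => \prod_(i | P i) F i x).
Proof. apply: continuous_big; exact: mul_continuous. Qed.

End RealContinuity.

(** * Barycentric coordinates on a realization *)

Section Coordinates.
Variables (R : realType) (V : finType) (X : complex V).
Implicit Type x : realization R X.

Definition coord x (v : V) : R := val x v.

Definition supp x : {set V} := [set v | coord x v != 0].

Lemma coord_ge0 x v : 0 <= coord x v.
Proof. by have /set_mem[x0 _ _] := valP x; exact: x0. Qed.

Lemma coord_sum x : \sum_v coord x v = 1.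
Proof. by have /set_mem[_ x1 _] := valP x. Qed.

Lemma supp_simplex x : supp x \in simplices X.
Proof. by have /set_mem[_ _ xX] := valP x. Qed.

Lemma coord_inj x y : coord x =1 coord y -> x = y.
Proof. by move=> xy; apply: val_inj; apply: funext. Qed.

Lemma coord_gt0 x v : (0 < coord x v) = (v \in supp x).
Proof. by rewrite inE lt0r coord_ge0 andbT. Qed.

Lemma supp_neq0 x : supp x != set0.
Proof.
by apply: contraTneq (supp_simplex x) => ->; exact: simplex_neq0.
Qed.

Lemma coord_continuous v : continuous (coord^~ v).
Proof.
move=> x.
apply: (@continuous_comp (realization R X) {ptws V -> R} R val (fun f => f v)).
  exact: initial_continuous.
exact: (@proj_continuous V (fun=> R : topologicalType) v).
Qed.

(** The realization carries the initial topology of its inclusion in R^V, and R^V that of its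
    projections, so continuity can be tested one coordinate at a time. *)
Lemma continuous_coord (A : topologicalType) (f : A -> realization R X) :
  (forall v, continuous (fun a => coord (f a) v)) -> continuous f.
Proof.
move=> fc; apply: continuous_comp_initial => a.
by apply/cvg_sup => v; apply: continuous_comp_initial => ?; exact: fc.
Qed.

Section MkPoint.
Variable c : V -> R.
Hypothesis c_ge0 : forall v, 0 <= c v.
Hypothesis c_sum : \sum_v c v = 1.
Hypothesis c_supp : [set v | c v != 0] \in simplices X.

Fact mkpoint_subproof : c \in (realization_set X : set {ptws V -> R}).
Proof. exact/mem_set. Qed.

Definition mkpoint : realization R X := exist _ (c : {ptws V -> R}) mkpoint_subproof.

End MkPoint.

End Coordinates.

(** * Equivariant homotopies into a realization *)

Section Homotopy.
Variables (R : realType) (gT : finGroupType).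
Variables (A : topologicalType) (aA : {action gT &-> A}).
Variables (W : finType) (Y : complex W) (b : simplicial_action gT Y).
Local Notation B := (realization R Y).
Local Notation rb := (realization_action R b).
Implicit Types f g h : A -> B.

Lemma coord_act (y : B) k w : coord (rb y k) w = coord y (b w k^-1%g).
Proof. by []. Qed.

(* Homotopies are indexed by all of R, which makes them continuous on an honest
   product; clamping recovers this from a homotopy indexed by [0, 1]. *)
Definition homotopic f g := exists H : R * A -> B,
  [/\ continuous H, forall x, H (0, x) = f x, forall x, H (1, x) = g x &
      forall t, equivariant aA rb (fun x => H (t, x))].

(** The retraction of R onto [0, 1], in a form whose continuity follows from that of the absolute
    value. *)
Definition clamp (t : R) : R := (1 + `|t| - `|1 - t|) / 2.

Lemma clamp_le0 t : t <= 0 -> clamp t = 0.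
Proof.
move=> t0; rewrite /clamp ler0_norm // ger0_norm; last by lra.
by field.
Qed.

Lemma clamp_ge1 t : 1 <= t -> clamp t = 1.
Proof.
move=> t1; rewrite /clamp ger0_norm ?ler0_norm; [by field|by lra|by lra].
Qed.

Lemma clamp_id t : 0 <= t <= 1 -> clamp t = t.
Proof.
by case/andP=> t0 t1; rewrite /clamp !ger0_norm; [field|lra|lra].
Qed.

Lemma clamp_itv t : 0 <= clamp t <= 1.
Proof.
have [t0|t0] := leP t 0; first by rewrite clamp_le0 // lexx ler01.
have [t1|t1] := leP 1 t; first by rewrite clamp_ge1 // lexx ler01.
by rewrite clamp_id ?ltW.
Qed.

Lemma continuous_clamp (T : topologicalType) (f : T -> R) :
  continuous f -> continuous (fun x => clamp (f x)).
Proof.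
move=> fc; apply: continuous_mul; last by move=> x; exact: cvg_cst.
apply: continuous_sub; last first.
  by apply: continuous_abs; apply: continuous_sub => // x; exact: cvg_cst.
apply: continuous_add; first by move=> x; exact: cvg_cst.
exact: continuous_abs.
Qed.

Lemma homotopic_sym f g : homotopic f g -> homotopic g f.
Proof.
case=> H [Hc H0 H1 He]; exists (fun p => H (1 - p.1, p.2)); split.
- apply: continuous_compose Hc; apply: continuous_pair; last exact: continuous_snd.
  apply: continuous_sub; last exact: continuous_fst.
  by move=> p; exact: cvg_cst.
- by move=> x; rewrite subr0.
- by move=> x; rewrite subrr.
- by move=> t; exact: (He (1 - t)).
Qed.

Section Concatenation.
Variables (H1 H2 : R * A -> B) (g : A -> B).
Hypotheses (Hc1 : continuous H1) (Hc2 : continuous H2).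
Hypotheses (H1g : forall x, H1 (1, x) = g x) (H2g : forall x, H2 (0, x) = g x).

Let K1 (p : R * A) := H1 (clamp (2 * p.1), p.2).
Let K2 (p : R * A) := H2 (clamp (2 * p.1 - 1), p.2).

(* At every time one of the two homotopies rests at g, so these are the
   coordinates of the concatenation; no pasting lemma is needed. *)
Let cc (p : R * A) (w : W) : R :=
  coord (K1 p) w + coord (K2 p) w - coord (g p.2) w.

Let ccE p : cc p =1 coord (if p.1 <= 2^-1 then K1 p else K2 p).
Proof.
move=> w; rewrite /cc /K1 /K2; case: leP => tp.
  rewrite [clamp (2 * p.1 - 1)]clamp_le0 ?H2g ?addrK //; lra.
by rewrite [clamp (2 * p.1)]clamp_ge1 ?H1g 1?addrC ?addKr //; lra.
Qed.

Lemma concat_continuous :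
  continuous (fun p : R * A => if p.1 <= 2^-1 then K1 p else K2 p).
Proof.
apply: continuous_coord => w.
rewrite (_ : (fun _ => _) = (fun p => cc p w)); last first.
  by apply: funext => p; rewrite ccE.
have Kc (H : R * A -> B) (r s : R) : continuous H ->
    continuous (fun p : R * A => coord (H (clamp (r * p.1 - s), p.2)) w).
  move=> Hc; apply: continuous_compose (@coord_continuous _ _ _ w).
  apply: continuous_compose Hc.
  apply: continuous_pair; last exact: continuous_snd.
  apply: continuous_clamp; apply: continuous_sub; last by move=> q; exact: cvg_cst.
  by apply: continuous_mul; [move=> q; exact: cvg_cst|exact: continuous_fst].
apply: continuous_sub.
  apply: continuous_add; last exact: Kc.
  by have := Kc H1 2 0 Hc1; under eq_fun do rewrite subr0.
(* [g] is continuous because it is the end of [H1]. *)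
under eq_fun do rewrite -H1g.
apply: continuous_compose (@coord_continuous _ _ _ w).
apply: continuous_compose Hc1; apply: continuous_pair; last exact: continuous_snd.
by move=> p; exact: cvg_cst.
Qed.

End Concatenation.

Lemma homotopic_trans g f h : homotopic f g -> homotopic g h -> homotopic f h.
Proof.
case=> H1 [Hc1 H10 H11 He1] [H2 [Hc2 H20 H21 He2]].
exists (fun p : R * A => if p.1 <= 2^-1 then H1 (clamp (2 * p.1), p.2)
                else H2 (clamp (2 * p.1 - 1), p.2)); split.
- exact: concat_continuous H11 H20.
- by move=> x; rewrite /= ifT ?mulr0 ?clamp_le0 // invr_ge0.
- move=> x; rewrite /= ifF ?clamp_ge1 //; first by lra.
  by apply/negbTE; rewrite -ltNge; lra.
- by move=> t x k /=; case: ifP => _; [exact: He1|exact: He2].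
Qed.

Lemma homotopicW f g :
  homotopic f g -> equivariant_homotopic R aA rb f g.
Proof.
case=> H [Hc H0 H1 He]; exists H; split=> //.
exact: continuous_subspaceT.
Qed.

Section Contiguous.
Variables f g : A -> B.
Hypothesis fg : forall x, exists2 s, s \in simplices Y &
  (supp (f x) \subset s) && (supp (g x) \subset s).

Let cc (p : R * A) (w : W) : R :=
  (1 - clamp p.1) * coord (f p.2) w + clamp p.1 * coord (g p.2) w.

Let cc_ge0 p w : 0 <= cc p w.
Proof.
have /andP[t0 t1] := clamp_itv p.1.
by rewrite addr_ge0 // mulr_ge0 ?coord_ge0 // subr_ge0.
Qed.

Let cc_sum p : \sum_w cc p w = 1.
Proof. by rewrite big_split /= -!mulr_sumr !coord_sum !mulr1 subrK. Qed.

Let cc_supp p : [set w | cc p w != 0] \in simplices Y.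
Proof.
have [s sY /andP[/subsetP fs /subsetP gs]] := fg p.2.
apply: simplex_sub sY _ _.
  apply/subsetP => w; rewrite inE; apply: contraR => ws.
  have /negbNE/eqP fw : ~~ (coord (f p.2) w != 0).
    by apply: contra ws => fw; apply: fs; rewrite inE.
  have /negbNE/eqP gw : ~~ (coord (g p.2) w != 0).
    by apply: contra ws => gw; apply: gs; rewrite inE.
  by rewrite /cc fw gw !mulr0 addr0.
apply/set0Pn; apply: contrapT => /forallNP c0.
have := cc_sum p; rewrite big1 => [/eqP|w _]; first by rewrite eq_sym oner_eq0.
by apply/eqP/negbNE/negP => cw; apply: (c0 w); rewrite inE.
Qed.

(** Both values lie in one closed simplex, so the straight segment between them stays in the
    realization of [Y]; affine combinations commute with permuting coordinates. *)
Lemma contiguous_homotopic :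
  continuous f -> continuous g -> equivariant aA rb f -> equivariant aA rb g ->
  homotopic f g.
Proof.
move=> fc gc fe ge.
exists (fun p => mkpoint (cc_ge0 p) (cc_sum p) (cc_supp p)); split.
- apply: continuous_coord => w; rewrite /coord /= /cc.
  have clc : continuous (fun p : R * A => clamp p.1).
    by apply: continuous_clamp => p; exact: cvg_fst.
  have coc h : continuous h -> continuous (fun p : R * A => coord (h p.2) w).
    move=> hc; apply: continuous_compose (@coord_continuous _ _ _ w).
    by apply: continuous_compose hc; exact: continuous_snd.
  apply: continuous_add; apply: continuous_mul; rewrite //; try exact: coc.
  by apply: continuous_sub => // p; exact: cvg_cst.
- move=> x; apply: coord_inj => w; rewrite {1}/coord /= /cc.
  by rewrite /= clamp_le0 // subr0 mul0r addr0 mul1r.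
- move=> x; apply: coord_inj => w; rewrite {1}/coord /= /cc.
  by rewrite /= clamp_ge1 // subrr mul0r add0r mul1r.
- move=> t x k; apply: coord_inj => w.
  by rewrite coord_act {1 2}/coord /= /cc /= fe ge !coord_act.
Qed.

End Contiguous.

End Homotopy.

(** * Barycentric subdivision *)

Section Affine.
Variables (R : realType) (V W : finType) (X : complex V) (Y : complex W).
Variable wt : V -> W -> R.
Hypothesis wt_ge0 : forall v w, 0 <= wt v w.
Hypothesis wt_sum : forall v, \sum_w wt v w = 1.
Hypothesis wt_simplex : forall s, s \in simplices X ->
  [set w | [exists v in s, wt v w != 0]] \in simplices Y.

Let cc (x : realization R X) (w : W) : R := \sum_v coord x v * wt v w.

Let cc_ge0 x w : 0 <= cc x w.
Proof. by apply: sumr_ge0 => v _; rewrite mulr_ge0 ?coord_ge0. Qed.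

Let cc_sum x : \sum_w cc x w = 1.
Proof.
rewrite exchange_big -[RHS](coord_sum x); apply: eq_bigr => v _.
by rewrite -mulr_sumr wt_sum mulr1.
Qed.

Let cc_supp x :
  [set w | cc x w != 0] = [set w | [exists v in supp x, wt v w != 0]].
Proof.
apply/setP => w; rewrite !inE /cc psumr_neq0; last first.
  by move=> v _; rewrite mulr_ge0 ?coord_ge0.
apply/hasP/exists_inP => [[v _ /=]|[v xv vw]].
  rewrite lt0r mulf_eq0 negb_or => /andP[/andP[xv vw] _].
  by exists v; rewrite ?inE.
rewrite inE in xv; exists v; first exact: mem_index_enum.
by rewrite /= lt0r mulf_neq0 ?mulr_ge0 ?coord_ge0.
Qed.

Let cc_simplex x : [set w | cc x w != 0] \in simplices Y.
Proof. by rewrite cc_supp wt_simplex // supp_simplex. Qed.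

(** The affine extension of the assignment of the point with coordinates [wt v] to each vertex [v].
    Weights 0 and 1 give the simplicial maps, uniform weights on faces the barycentric map. *)
Definition affine x : realization R Y :=
  mkpoint (cc_ge0 x) (cc_sum x) (cc_simplex x).

Lemma supp_affine x :
  supp (affine x) = [set w | [exists v in supp x, wt v w != 0]].
Proof. exact: cc_supp. Qed.

Lemma coord_affine x w : coord (affine x) w = \sum_v coord x v * wt v w.
Proof. by []. Qed.

Lemma affine_continuous : continuous affine.
Proof.
apply: continuous_coord => w; apply: continuous_sum => v _.
apply: continuous_mul; first exact: coord_continuous.
exact: cst_continuous.
Qed.

Lemma affine_equivariant (gT : finGroupType) (a : simplicial_action gT X)
    (b : simplicial_action gT Y) :
  (forall v w k, wt (a v k) (b w k) = wt v w) ->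
  equivariant (realization_action R a) (realization_action R b) affine.
Proof.
move=> wtE x k; apply: coord_inj => w; rewrite coord_act !coord_affine.
rewrite (reindex_inj (act_inj a k)); apply: eq_bigr => v _.
by rewrite coord_act actK -{1}(actKV b k w) wtE.
Qed.

End Affine.

Record simplicial_map (V W : finType) (X : complex V) (Y : complex W) :=
  SimplicialMap {
    vertex_map :> V -> W;
    simplicial_mapP : forall s, s \in simplices X ->
      [set vertex_map v | v in s] \in simplices Y
  }.

Lemma sum_indicator (R : realType) (V : finType) (v : V) :
  \sum_w (v == w)%:R = 1 :> R.
Proof.
rewrite (bigD1 v) //= eqxx big1 ?addr0 // => w.
by rewrite eq_sym => /negbTE->.
Qed.

Section VertexPoint.
Variables (R : realType) (V : finType) (X : complex V).

Let vertex_point_ge0 (v w : V) : 0 <= (v == w)%:R :> R.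
Proof. exact: ler0n. Qed.

Let vertex_point_simplex (v : V) :
  [set w | (v == w)%:R != 0 :> R] \in simplices X.
Proof.
rewrite (_ : [set w | _] = [set v]) ?simplex_vertex //.
by apply/setP => w; rewrite !inE pnatr_eq0 eqb0 negbK eq_sym.
Qed.

(** Barycenters of faces are the images under [barycentric] of such points of the subdivision; this
    is how freeness on the realization reaches the faces. *)
Definition vertex_point (v : V) : realization R X :=
  mkpoint (vertex_point_ge0 v) (sum_indicator R v) (vertex_point_simplex v).

Lemma vertex_point_equivariant (gT : finGroupType)
    (a : simplicial_action gT X) v k :
  vertex_point (a v k) = realization_action R a (vertex_point v) k.
Proof.
apply: coord_inj => w; rewrite coord_act /coord /=.
by rewrite -{1}(actKV a k w) (inj_eq (act_inj a k)).
Qed.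

End VertexPoint.

Section Realize.
Variables (R : realType) (V W : finType) (X : complex V) (Y : complex W).
Variable F : simplicial_map X Y.

Let wt (v : V) (w : W) : R := (F v == w)%:R.

Let wt_sum v : \sum_w wt v w = 1.
Proof. exact: sum_indicator. Qed.

Let wt_set (s : {set V}) :
  [set w | [exists v in s, wt v w != 0]] = [set F v | v in s].
Proof.
apply/setP => w; rewrite inE; apply/exists_inP/imsetP => -[v vs].
  by rewrite /wt pnatr_eq0 eqb0 negbK => /eqP<-; exists v.
by move=> ->; exists v; rewrite // /wt eqxx oner_eq0.
Qed.

Let wt_simplex s : s \in simplices X ->
  [set w | [exists v in s, wt v w != 0]] \in simplices Y.
Proof. by rewrite wt_set; exact: simplicial_mapP. Qed.

Definition realize : realization R X -> realization R Y :=
  affine (fun v w => ler0n R (F v == w)) wt_sum wt_simplex.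

Lemma supp_realize x : supp (realize x) = [set F v | v in supp x].
Proof. by rewrite supp_affine wt_set. Qed.

Lemma realize_continuous : continuous realize.
Proof. exact: affine_continuous. Qed.

Lemma realize_equivariant (gT : finGroupType) (a : simplicial_action gT X)
    (b : simplicial_action gT Y) :
  (forall v k, F (a v k) = b (F v) k) ->
  equivariant (realization_action R a) (realization_action R b) realize.
Proof.
move=> FE; apply: affine_equivariant => v w k.
by rewrite /wt FE (inj_eq (act_inj b k)).
Qed.

End Realize.

Lemma is_chainP d (P : finPOrderType d) (c : {set P}) :
  reflect {in c &, forall x y, (x >=< y)%O} (is_chain c).
Proof.
apply: (iffP forall_inP) => [cc x y xc yc|cc x xc].
  by have /forall_inP := cc x xc; apply.
by apply/forall_inP => y; exact: cc.
Qed.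

Lemma chainsP d (P : finPOrderType d) (c : {set P}) :
  reflect (c != set0 /\ {in c &, forall x y, (x >=< y)%O})
    (c \in simplices (order_complex P)).
Proof.
rewrite inE; apply: (iffP andP) => -[c0 /is_chainP cc]; split=> //.
Qed.

(** * The comparison maps between a complex and its subdivision *)

Section Subdivision.
Variables (R : realType) (V : finType) (X : complex V).
Local Notation sdX := (order_complex (face X)).
Implicit Types (s t : face X).

Lemma face_neq0 s : fset_of s != set0.
Proof.
by apply: contraTneq (face_simplex s) => ->; exact: simplex_neq0.
Qed.

(** A face of largest cardinality in a chain contains all the others. *)
Lemma chain_cover_face (c : {set face X}) : c \in simplices sdX ->
  exists2 s, s \in c & \bigcup_(t in c) fset_of t = fset_of s.
Proof.
case/chainsP => /set0Pn[s0 s0c] cc.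
have [s sc smax] := arg_maxnP (fun s => #|fset_of s|) s0c.
exists s => //; apply/eqP; rewrite eqEsubset (bigcup_sup s) // andbT.
apply/bigcupsP => t tc; have /orP[//|st] := cc t s tc sc.
suff /eqP-> : fset_of s == fset_of t by [].
by rewrite eqEcard; apply/andP; split; [exact: st|exact: smax].
Qed.

Section Barycenter.

Let wt (s : face X) (v : V) : R := (v \in fset_of s)%:R / #|fset_of s|%:R.

Let card_neq0 s : #|fset_of s|%:R != 0 :> R.
Proof. by rewrite pnatr_eq0 cards_eq0 face_neq0. Qed.

Let wt_ge0 s v : 0 <= wt s v. Proof. by rewrite divr_ge0 ?ler0n. Qed.

Let wt_sum s : \sum_v wt s v = 1.
Proof.
by rewrite -mulr_suml -natr_sum -big_mkcond /= sum1_card divff ?card_neq0.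
Qed.

Let wt_set (c : {set face X}) :
  [set v | [exists s in c, wt s v != 0]] = \bigcup_(s in c) fset_of s.
Proof.
apply/setP => v; rewrite inE; apply/exists_inP/bigcupP => -[s sc].
  rewrite /wt mulf_eq0 negb_or pnatr_eq0 eqb0 negbK => /andP[vs _].
  by exists s.
by move=> vs; exists s; rewrite // /wt vs mul1r invr_eq0.
Qed.

Let wt_simplex c : c \in simplices sdX ->
  [set v | [exists s in c, wt s v != 0]] \in simplices X.
Proof.
by rewrite wt_set => /chain_cover_face[s _ ->]; exact: face_simplex.
Qed.

Definition barycentric : realization R sdX -> realization R X :=
  affine wt_ge0 wt_sum wt_simplex.

Lemma supp_barycentric y :
  supp (barycentric y) = \bigcup_(s in supp y) fset_of s.
Proof. by rewrite supp_affine wt_set. Qed.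

Lemma barycentric_continuous : continuous barycentric.
Proof. exact: affine_continuous. Qed.

Lemma barycentric_equivariant (gT : finGroupType) (a : simplicial_action gT X) :
  equivariant (realization_action R (order_complex_action (face_action a)))
    (realization_action R a) barycentric.
Proof.
apply: affine_equivariant => s v k; rewrite /wt /=.
by rewrite (card_imset _ (act_inj a k)) (mem_imset _ _ (act_inj a k)).
Qed.

(** The coordinate at [v] sums the contributions of the faces containing [v], and each of these
    contributes equally at [u]. This relates superlevel sets to flags. *)
Lemma barycentric_mono (y : realization R sdX) u v :
  (forall s, s \in supp y -> v \in fset_of s -> u \in fset_of s) ->
  coord (barycentric y) v <= coord (barycentric y) u.
Proof.
move=> vu; rewrite !coord_affine; apply: ler_sum => s _.
have [->|ys] := eqVneq (coord y s) 0; first by rewrite !mul0r.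
rewrite ler_wpM2l ?coord_ge0 // /wt ler_wpM2r ?invr_ge0 ?ler0n //.
by case vs: (v \in _); rewrite ?ler0n // vu ?inE.
Qed.

End Barycenter.

Section LevelSets.

(* Nonzero exactly when s is a strict superlevel set of x inside supp x; such
   sets form a flag. *)
Definition level_weight (x : realization R X) (s : {set V}) : R :=
  \prod_(v in s)
    (coord x v * \prod_(u in ~: s) Num.max 0 (coord x v - coord x u)).

Lemma level_weight_ge0 x (s : {set V}) : 0 <= level_weight x s.
Proof.
apply: prodr_ge0 => v _; rewrite mulr_ge0 ?coord_ge0 //.
by apply: prodr_ge0 => u _; rewrite le_max lexx.
Qed.

Lemma level_weight_neq0 x (s : {set V}) : reflect
  (forall v, v \in s ->
     v \in supp x /\ forall u, u \notin s -> coord x u < coord x v)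
  (level_weight x s != 0).
Proof.
rewrite /level_weight; apply: (iffP (prodf_neq0 _ _)) => [xs v vs|xs v vs].
  have := xs v vs; rewrite mulf_eq0 negb_or => /andP[xv /prodf_neq0 xu].
  split=> [|u us]; first by rewrite inE.
  have := xu u; rewrite inE us => /(_ isT); apply: contraR.
  by rewrite -leNgt -subr_le0 => vu; rewrite max_l.
have [xv xu] := xs v vs; rewrite inE in xv; rewrite mulf_neq0 //.
apply/prodf_neq0 => u; rewrite inE => us.
by rewrite max_r; have := xu u us; rewrite -subr_gt0 => h; rewrite ?gt_eqF ?ltW.
Qed.

Let total (x : realization R X) : R := \sum_(s : face X) level_weight x s.

Let total_gt0 x : 0 < total x.
Proof.
(* The support of [x] is itself a strict superlevel set, so its weight is positive. *)
rewrite /total (bigD1 (Face (supp_simplex x))) //=.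
rewrite ltr_wpDr //; first by apply: sumr_ge0 => s _; exact: level_weight_ge0.
rewrite lt0r; apply/andP; split; last exact: level_weight_ge0.
apply/level_weight_neq0 => v vx.
by split=> // u; rewrite -coord_gt0 -leNgt => xu; rewrite (le_lt_trans xu) ?coord_gt0.
Qed.

Let cc x (s : face X) : R := level_weight x s / total x.

Let cc_ge0 x s : 0 <= cc x s.
Proof. by rewrite divr_ge0 ?level_weight_ge0 // ltW // total_gt0. Qed.

Let cc_sum x : \sum_s cc x s = 1.
Proof. by rewrite -mulr_suml divff // gt_eqF // total_gt0. Qed.

Let cc_neq0 x s : (cc x s != 0) = (level_weight x s != 0).
Proof. by rewrite mulf_eq0 invr_eq0 [total x == 0]gt_eqF ?total_gt0 // orbF. Qed.

Let cc_simplex x : [set s | cc x s != 0] \in simplices sdX.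
Proof.
apply/chainsP; split=> [|s t].
  apply/set0Pn; apply: contrapT => /forallNP c0.
  have := cc_sum x; rewrite big1 => [/eqP|s _]; first by rewrite eq_sym oner_eq0.
  by apply/eqP/negbNE/negP => cs; apply: (c0 s); rewrite inE.
rewrite !inE !cc_neq0 => /level_weight_neq0 xs /level_weight_neq0 xt.
apply: contraT; rewrite negb_or.
case/andP => /subsetPn[v vs vt] /subsetPn[u ut us].
have [_ /(_ u us) uv] := xs v vs; have [_ /(_ v vt) vu] := xt u ut.
by have := lt_trans uv vu; rewrite ltxx.
Qed.

(** A homotopy inverse of [barycentric], not its inverse: the exact inverse involves sorting the
    coordinates of [x], whereas these weights are visibly continuous. *)
Definition subdivide (x : realization R X) : realization R sdX :=
  mkpoint (cc_ge0 x) (cc_sum x) (cc_simplex x).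

Lemma supp_subdivide x s :
  (s \in supp (subdivide x)) = (level_weight x s != 0).
Proof. by rewrite inE cc_neq0. Qed.

Lemma supp_subdivide_sub x s : s \in supp (subdivide x) -> fset_of s \subset supp x.
Proof.
by rewrite supp_subdivide => /level_weight_neq0 xs; apply/subsetP => v /xs[].
Qed.

Lemma level_weight_continuous (s : {set V}) :
  continuous (fun x => level_weight x s).
Proof.
apply: continuous_prod => v _; apply: continuous_mul.
  exact: coord_continuous.
apply: continuous_prod => u _; apply: continuous_maxr; first exact: cst_continuous.
by apply: continuous_sub; exact: coord_continuous.
Qed.

Lemma subdivide_continuous : continuous subdivide.
Proof.
apply: continuous_coord => s; apply: continuous_mul.
  exact: level_weight_continuous.
apply: continuous_inv => [x|]; first by rewrite gt_eqF ?total_gt0.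
by apply: continuous_sum => t _; exact: level_weight_continuous.
Qed.

Variables (gT : finGroupType) (a : simplicial_action gT X).

Lemma level_weight_act x (s : {set V}) k :
  level_weight (realization_action R a x k) [set a v k | v in s] =
  level_weight x s.
Proof.
rewrite /level_weight big_imset /=; last by move=> u v _ _; exact: act_inj.
apply: eq_bigr => v vs; rewrite coord_act actK; congr (_ * _).
rewrite (reindex_inj (act_inj a k)) /=; apply: eq_big => [u|u _].
  by rewrite !inE (mem_imset _ _ (act_inj a k)).
by rewrite coord_act actK.
Qed.

Lemma subdivide_equivariant :
  equivariant (realization_action R a)
    (realization_action R (order_complex_action (face_action a))) subdivide.
Proof.
move=> x k; apply: coord_inj => s; rewrite coord_act.
have sE (y : realization R X) t :
  level_weight (realization_action R a y k) (face_action a t k) =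
  level_weight y t by exact: level_weight_act.
rewrite /coord /= /cc; congr (_ / _).
  by rewrite -[in LHS](actKV (face_action a) k s) sE.
rewrite /total (reindex_inj (act_inj (face_action a) k)).
by apply: eq_bigr => t _; exact: sE.
Qed.

(** The superlevel sets occurring in [subdivide x] lie in [supp x], so the composite never leaves
    the closed simplex of [x]. *)
Lemma barycentric_subdivide :
  homotopic (realization_action R a) a (fun x => barycentric (subdivide x)) id.
Proof.
apply: contiguous_homotopic => [x| | | |].
- exists (supp x); first exact: supp_simplex.
  rewrite subxx andbT supp_barycentric; apply/bigcupsP => s.
  exact: supp_subdivide_sub.
- exact: continuous_compose subdivide_continuous barycentric_continuous.
- by move=> x; exact: cvg_id.
- by move=> x k; rewrite subdivide_equivariant barycentric_equivariant.
- by [].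
Qed.

(** The strict superlevel sets of [barycentric y] are comparable with the faces of the flag
    [supp y], so both flags together span one simplex of the subdivision. *)
Lemma subdivide_barycentric :
  homotopic (realization_action R (order_complex_action (face_action a)))
    (order_complex_action (face_action a))
    (fun y => subdivide (barycentric y)) id.
Proof.
apply: contiguous_homotopic => [y| | | |].
- exists (supp (subdivide (barycentric y)) :|: supp y); last first.
    by rewrite subsetUl subsetUr.
  have /chainsP[_ yc] := supp_simplex y.
  have /chainsP[_ sc] := supp_simplex (subdivide (barycentric y)).
  have mixed s t : s \in supp (subdivide (barycentric y)) -> t \in supp y ->
      (s >=< t)%O.
    rewrite supp_subdivide => /level_weight_neq0 ys yt.
    apply: contraT; rewrite negb_or.
    case/andP => /subsetPn[v vs vt] /subsetPn[u ut us].
    have [_ /(_ u us)] := ys v vs; rewrite ltNge => /negP[].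
    (* A face [t'] of the flag that contains [v] is not inside [t], hence contains [t] and so
       [u]. *)
    apply: barycentric_mono => t' yt' vt'.
    have /orP[/subsetP t't|/subsetP tt'] := yc t' t yt' yt; last exact: tt'.
    by rewrite (t't v vt') in vt.
  apply/chainsP; split=> [|s t].
    have /set0Pn[s sy] := supp_neq0 y.
    by apply/set0Pn; exists s; rewrite inE sy orbT.
  rewrite !in_setU => /orP[]sy /orP[]ty; [exact: sc|exact: mixed| |exact: yc].
  by rewrite comparable_sym; exact: mixed.
- exact: continuous_compose barycentric_continuous subdivide_continuous.
- by move=> y; exact: cvg_id.
- by move=> y k; rewrite barycentric_equivariant subdivide_equivariant.
- by [].
Qed.

End LevelSets.
End Subdivision.

(** * Equivariant maps and homotopy equivalences *)

Section EquivariantMaps.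
Variables (R : realType) (gT : finGroupType).
Local Notation ract := (realization_action R).

Record emap (V W : finType) (X : complex V) (Y : complex W)
    (a : simplicial_action gT X) (b : simplicial_action gT Y) := EMap {
  emap_fun :> realization R X -> realization R Y;
  emap_continuous : continuous emap_fun;
  emap_equivariant : equivariant (ract a) (ract b) emap_fun
}.

Section Bundled.
Variables (U V W : finType) (X : complex U) (Y : complex V) (Z : complex W).
Variables (a : simplicial_action gT X) (b : simplicial_action gT Y).
Variable c : simplicial_action gT Z.

Definition eid : emap a a :=
  EMap (fun x => cvg_id) (fun x k => erefl : ract a x k = ract a x k).

Fact ecomp_equivariant (g : emap b c) (f : emap a b) :
  equivariant (ract a) (ract c) (fun x => g (f x)).
Proof. by move=> x k; rewrite !emap_equivariant. Qed.

Definition ecomp (g : emap b c) (f : emap a b) : emap a c :=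
  EMap (continuous_compose (@emap_continuous _ _ _ _ _ _ f)
          (@emap_continuous _ _ _ _ _ _ g))
    (ecomp_equivariant g f).

Lemma homotopic_contiguous (f g : emap a b) :
  (forall x, exists2 s, s \in simplices Y &
    (supp (f x) \subset s) && (supp (g x) \subset s)) ->
  homotopic (ract a) b f g.
Proof.
move=> fg; apply: contiguous_homotopic fg _ _ _ _.
- exact: emap_continuous.
- exact: emap_continuous.
- exact: emap_equivariant.
- exact: emap_equivariant.
Qed.

Lemma homotopic_supp (f g : emap a b) :
  (forall x, supp (f x) \subset supp (g x)) -> homotopic (ract a) b f g.
Proof.
move=> fg; apply: homotopic_contiguous => x.
by exists (supp (g x)); rewrite ?supp_simplex ?fg /=.
Qed.

Lemma homotopic_compl (h : emap b c) (f g : realization R X -> realization R Y) :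
  homotopic (ract a) b f g ->
  homotopic (ract a) c (fun x => h (f x)) (fun x => h (g x)).
Proof.
case=> H [Hc H0 H1 He]; exists (fun p => h (H p)); split.
- exact: continuous_compose Hc (@emap_continuous _ _ _ _ _ _ h).
- by move=> x; rewrite H0.
- by move=> x; rewrite H1.
- by move=> t x k; rewrite (He t) emap_equivariant.
Qed.

Lemma homotopic_compr (h : emap a b) (f g : realization R Y -> realization R Z) :
  homotopic (ract b) c f g ->
  homotopic (ract a) c (fun x => f (h x)) (fun x => g (h x)).
Proof.
case=> H [Hc H0 H1 He]; exists (fun p => H (p.1, h p.2)); split.
- apply: continuous_compose Hc; apply: continuous_pair.
    exact: continuous_fst.
  apply: continuous_compose (@emap_continuous _ _ _ _ _ _ h).
  exact: continuous_snd.
- by move=> x; exact: H0.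
- by move=> x; exact: H1.
- by move=> t x k /=; rewrite emap_equivariant (He t).
Qed.

End Bundled.

Section Equivalence.
Variables (U V : finType) (X : complex U) (Y : complex V).
Variables (a : simplicial_action gT X) (b : simplicial_action gT Y).

Definition homotopy_equiv := exists (f : emap a b) (g : emap b a),
  homotopic (ract a) a (fun x => g (f x)) id /\
  homotopic (ract b) b (fun y => f (g y)) id.

Lemma homotopy_equivW :
  homotopy_equiv -> equivariant_homotopy_equiv R (ract a) (ract b).
Proof.
case=> f [g [gf fg]]; exists f, g; split.
- by split; [exact: emap_continuous|exact: emap_equivariant].
- by split; [exact: emap_continuous|exact: emap_equivariant].
- exact: homotopicW gf.
- exact: homotopicW fg.
Qed.

End Equivalence.

Lemma homotopy_equiv_trans (U V W : finType) (X : complex U) (Y : complex V)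
    (Z : complex W) (a : simplicial_action gT X) (b : simplicial_action gT Y)
    (c : simplicial_action gT Z) :
  homotopy_equiv a b -> homotopy_equiv b c -> homotopy_equiv a c.
Proof.
case=> f [g [gf fg]] [f' [g' [gf' fg']]]; exists (ecomp f' f), (ecomp g g').
split.
  exact: homotopic_trans (homotopic_compl g (homotopic_compr f gf')) gf.
exact: homotopic_trans (homotopic_compl f' (homotopic_compr g' fg)) fg'.
Qed.

Section Subdivide.
Variables (V : finType) (X : complex V) (a : simplicial_action gT X).

Definition esubdivide : emap a (order_complex_action (face_action a)) :=
  EMap (@subdivide_continuous R V X) (subdivide_equivariant a).

Definition ebarycentric : emap (order_complex_action (face_action a)) a :=
  EMap (@barycentric_continuous R V X) (barycentric_equivariant a).

Lemma barycentric_equiv :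
  homotopy_equiv (order_complex_action (face_action a)) a.
Proof.
exists ebarycentric, esubdivide; split.
  exact: subdivide_barycentric.
exact: barycentric_subdivide.
Qed.

End Subdivide.

Record gsimplicial_map (V W : finType) (X : complex V) (Y : complex W)
    (a : simplicial_action gT X) (b : simplicial_action gT Y) :=
  GSimplicialMap {
    gsimplicial_val :> simplicial_map X Y;
    gsimplicial_act : forall v k,
      gsimplicial_val (a v k) = b (gsimplicial_val v) k
  }.

Section Functor.
Variables (V W : finType) (X : complex V) (Y : complex W).
Variables (a : simplicial_action gT X) (b : simplicial_action gT Y).
Variable F : gsimplicial_map a b.

Definition erealize : emap a b :=
  EMap (@realize_continuous R _ _ _ _ F)
    (realize_equivariant (@gsimplicial_act _ _ _ _ _ _ F)).

Definition face_map (s : face X) : face Y :=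
  Face (simplicial_mapP F (face_simplex s)).

Lemma face_map_le : {homo face_map : s t / (s <= t)%O}.
Proof. by move=> s t; exact: imsetS. Qed.

Lemma face_map_act s k :
  face_map (face_action a s k) = face_action b (face_map s) k.
Proof.
apply: val_inj; rewrite /= -!imset_comp; apply: eq_imset => v /=.
exact: gsimplicial_act.
Qed.

Fact face_map_simplicial c : c \in simplices (order_complex (face X)) ->
  [set face_map s | s in c] \in simplices (order_complex (face Y)).
Proof.
case/chainsP => c0 cc; apply/chainsP; split=> [|_ _ /imsetP[s sc ->] /imsetP[t tc ->]].
  by case/set0Pn: c0 => s sc; apply/set0Pn; exists (face_map s); exact: imset_f.
by case/orP: (cc s t sc tc) => st; apply/orP; [left|right]; exact: face_map_le.
Qed.

Definition gface_map : gsimplicial_map (order_complex_action (face_action a))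
    (order_complex_action (face_action b)) :=
  @GSimplicialMap _ _ _ _ (order_complex_action (face_action a))
    (order_complex_action (face_action b))
    (SimplicialMap face_map_simplicial) face_map_act.

End Functor.

(** Naturality holds only up to homotopy, since [F] adds the coordinates of identified vertices and
    so alters superlevel sets. The barycentric image of the pushed-forward flag of [x] stays in the
    closed simplex of [realize F x]; it remains to apply [subdivide] and cancel it against
    [barycentric]. *)
Lemma subdivide_natural (V W : finType) (X : complex V) (Y : complex W)
    (a : simplicial_action gT X) (b : simplicial_action gT Y)
    (F : gsimplicial_map a b) :
  homotopic (ract a) (order_complex_action (face_action b))
    (fun x => subdivide (realize F x))
    (fun x => realize (gface_map F) (subdivide x)).
Proof.
set FF := ecomp (erealize (gface_map F)) (esubdivide a).
apply: (@homotopic_trans _ _ _ _ _ _ _ (fun x => subdivide (barycentric (FF x)))).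
  apply: (homotopic_compl (esubdivide b)); apply: homotopic_sym.
  apply: (@homotopic_supp _ _ _ _ _ _ (ecomp (ebarycentric b) FF) (erealize F)).
  move=> x /=; rewrite supp_barycentric !supp_realize.
  apply/bigcupsP => _ /imsetP[s sx ->] /=.
  by apply: imsetS; exact: supp_subdivide_sub.
exact: (homotopic_compr FF (subdivide_barycentric R b)).
Qed.

End EquivariantMaps.

(** * Homotopies from poset maps *)

Section ChainExtrema.
Variables (d : Order.disp_t) (P : finPOrderType d).
Implicit Types (c : Chain P) (x y : P).

Lemma chain_neq0 c : exists x, x \in fset_of c.
Proof. exact/set0Pn/face_neq0. Qed.

Lemma chain_comparable c : {in fset_of c &, forall x y, (x >=< y)%O}.
Proof. by have /chainsP[] := face_simplex c. Qed.

(** The member of [c] with the most members of [c] below it is the largest. *)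
Fact chain_max_subproof c :
  exists x, (x \in fset_of c) && [forall y in fset_of c, (y <= x)%O].
Proof.
have [x0 x0c] := chain_neq0 c.
have [x xc xmax] :=
  arg_maxnP (fun x => #|[set y in fset_of c | (y <= x)%O]|) x0c.
exists x; rewrite [x \in _]xc; apply/forall_inP => y yc.
have /orP[//|xy] := chain_comparable yc xc.
have sub : [set z in fset_of c | (z <= x)%O] \subset
           [set z in fset_of c | (z <= y)%O].
  by apply/subsetP => z; rewrite !inE => /andP[-> /le_trans->].
have /eqP/setP/(_ y) : [set z in fset_of c | (z <= x)%O] ==
           [set z in fset_of c | (z <= y)%O].
  by rewrite eqEcard sub; exact: xmax.
by rewrite !inE lexx yc.
Qed.

Fact chain_min_subproof c :
  exists x, (x \in fset_of c) && [forall y in fset_of c, (x <= y)%O].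
Proof.
have [x0 x0c] := chain_neq0 c.
have [x xc xmax] :=
  arg_maxnP (fun x => #|[set y in fset_of c | (x <= y)%O]|) x0c.
exists x; rewrite [x \in _]xc; apply/forall_inP => y yc.
have /orP[//|yx] := chain_comparable xc yc.
have sub : [set z in fset_of c | (x <= z)%O] \subset
           [set z in fset_of c | (y <= z)%O].
  by apply/subsetP => z; rewrite !inE => /andP[-> /(le_trans yx)].
have /eqP/setP/(_ y) : [set z in fset_of c | (x <= z)%O] ==
           [set z in fset_of c | (y <= z)%O].
  by rewrite eqEcard sub; exact: xmax.
by rewrite !inE lexx yc.
Qed.

Definition chain_max c : P := xchoose (chain_max_subproof c).
Definition chain_min c : P := xchoose (chain_min_subproof c).

Lemma chain_max_in c : chain_max c \in fset_of c.
Proof. by have /andP[] := xchooseP (chain_max_subproof c). Qed.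

Lemma chain_min_in c : chain_min c \in fset_of c.
Proof. by have /andP[] := xchooseP (chain_min_subproof c). Qed.

Lemma le_chain_max c x : x \in fset_of c -> (x <= chain_max c)%O.
Proof. by have /andP[_ /forall_inP] := xchooseP (chain_max_subproof c); apply. Qed.

Lemma chain_min_le c x : x \in fset_of c -> (chain_min c <= x)%O.
Proof. by have /andP[_ /forall_inP] := xchooseP (chain_min_subproof c); apply. Qed.

Lemma le_chain c c' x : (c <= c')%O -> x \in fset_of c -> x \in fset_of c'.
Proof. by move=> /subsetP; apply. Qed.

Lemma chain_max_homo c c' : (c <= c')%O -> (chain_max c <= chain_max c')%O.
Proof. by move=> cc'; apply: le_chain_max; exact: le_chain cc' (chain_max_in c). Qed.

Lemma chain_min_anti c c' : (c <= c')%O -> (chain_min c' <= chain_min c)%O.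
Proof. by move=> cc'; apply: chain_min_le; exact: le_chain cc' (chain_min_in c). Qed.

Variables (gT : finGroupType) (a : poset_action gT P).

Lemma poset_act_le x y k : (a x k <= a y k)%O = (x <= y)%O.
Proof.
apply/idP/idP; last exact: poset_actP.
by move=> /(poset_actP a k^-1%g); rewrite !actK.
Qed.

Lemma chain_max_act c k : chain_max (chain_action a c k) = a (chain_max c) k.
Proof.
apply/le_anti/andP; split.
  have /imsetP[x xc ->] := chain_max_in (chain_action a c k).
  by rewrite poset_act_le le_chain_max.
by apply: le_chain_max; apply: imset_f; exact: chain_max_in.
Qed.

Lemma chain_min_act c k : chain_min (chain_action a c k) = a (chain_min c) k.
Proof.
apply/le_anti/andP; split.
  by apply: chain_min_le; apply: imset_f; exact: chain_min_in.
have /imsetP[x xc ->] := chain_min_in (chain_action a c k).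
by rewrite poset_act_le chain_min_le.
Qed.

End ChainExtrema.

Section OrderMap.
Variables (d d' : Order.disp_t) (Y : finPOrderType d) (Z : finPOrderType d').
Variables (gT : finGroupType) (aY : poset_action gT Y) (aZ : poset_action gT Z).
Variable F : Y -> Z.
Hypothesis F_comparable : forall x y, (x <= y)%O -> (F x >=< F y)%O.
Hypothesis F_act : forall x k, F (aY x k) = aZ (F x) k.

Fact order_map_simplicial c : c \in simplices (order_complex Y) ->
  [set F y | y in c] \in simplices (order_complex Z).
Proof.
case/chainsP => c0 cc; apply/chainsP; split=> [|_ _ /imsetP[s sc ->] /imsetP[t tc ->]].
  by case/set0Pn: c0 => s sc; apply/set0Pn; exists (F s); exact: imset_f.
by case/orP: (cc s t sc tc) => /F_comparable //; rewrite comparable_sym.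
Qed.

(** Asking only that comparable elements have comparable images covers monotone and antitone maps at
    once. *)
Definition gorder_map : gsimplicial_map (order_complex_action aY)
    (order_complex_action aZ) :=
  @GSimplicialMap _ _ _ _ _ (order_complex_action aY) (order_complex_action aZ)
    (SimplicialMap order_map_simplicial) F_act.

End OrderMap.

Lemma homo_comparable d d' (Y : finPOrderType d) (Z : finPOrderType d')
    (F : Y -> Z) : {homo F : x y / (x <= y)%O} ->
  forall x y, (x <= y)%O -> (F x >=< F y)%O.
Proof. by move=> Fh x y /Fh; exact: le_comparable. Qed.

Lemma anti_comparable d d' (Y : finPOrderType d) (Z : finPOrderType d')
    (F : Y -> Z) : {homo F : x y / (x <= y)%O >-> (y <= x)%O} ->
  forall x y, (x <= y)%O -> (F x >=< F y)%O.
Proof. by move=> Fh x y /Fh; exact: ge_comparable. Qed.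

Section PosetHomotopies.
Variables (R : realType) (gT : finGroupType).
Local Notation ract := (realization_action R).

Section Extrema.
Variables (d : Order.disp_t) (P : finPOrderType d) (a : poset_action gT P).

Definition gmax : gsimplicial_map (order_complex_action (chain_action a))
    (order_complex_action a) :=
  gorder_map (homo_comparable (@chain_max_homo d P)) (chain_max_act a).

Definition gmin : gsimplicial_map (order_complex_action (chain_action a))
    (order_complex_action a) :=
  gorder_map (anti_comparable (@chain_min_anti d P)) (chain_min_act a).

(** Every chain in the support of [subdivide x] is a subset of [supp x], so choosing a member of
    each keeps the point in the closed simplex of [x]. *)
Lemma realize_subdivide (F : gsimplicial_map
    (order_complex_action (chain_action a)) (order_complex_action a)) :
  (forall c, F c \in fset_of c) ->
  homotopic (ract (order_complex_action a)) (order_complex_action a)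
    (fun x => realize F (subdivide x)) id.
Proof.
move=> Fc; apply: (@homotopic_supp _ _ _ _ _ _ _ _
  (ecomp (erealize R F) (esubdivide R (order_complex_action a)))
  (eid R (order_complex_action a))) => x /=.
rewrite supp_realize; apply/subsetP => _ /imsetP[c cx ->].
exact: (subsetP (supp_subdivide_sub cx)).
Qed.

Lemma realize_max_subdivide :
  homotopic (ract (order_complex_action a)) (order_complex_action a)
    (fun x => realize gmax (subdivide x)) id.
Proof. exact/realize_subdivide/chain_max_in. Qed.

Lemma realize_min_subdivide :
  homotopic (ract (order_complex_action a)) (order_complex_action a)
    (fun x => realize gmin (subdivide x)) id.
Proof. exact/realize_subdivide/chain_min_in. Qed.

End Extrema.

(* The values F (chain_max c) and G (chain_min c), for c in a flag of chains,
   form a single chain. *)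
Lemma antitone_homotopic d d' (Y : finPOrderType d) (Z : finPOrderType d')
    (aY : poset_action gT Y) (aZ : poset_action gT Z)
    (F G : gsimplicial_map (order_complex_action aY) (order_complex_action aZ)) :
  {homo F : x y / (x <= y)%O >-> (y <= x)%O} ->
  {homo G : x y / (x <= y)%O >-> (y <= x)%O} ->
  (forall x, (F x <= G x)%O) ->
  homotopic (ract (order_complex_action aY)) (order_complex_action aZ)
    (realize F) (realize G).
Proof.
move=> Fa Ga FG.
have FGc (c c' : Chain Y) : (c >=< c')%O ->
    (F (chain_max c) <= G (chain_min c'))%O.
  move=> cc'; apply: le_trans (FG _) _; apply: Ga.
  case/orP: cc' => cc'.
    by apply: chain_min_le; exact: le_chain cc' (chain_max_in c).
  by apply: le_chain_max; exact: le_chain cc' (chain_min_in c').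
set S := esubdivide R (order_complex_action aY).
apply: (@homotopic_trans _ _ _ _ _ _ _
  (fun x => realize F (realize (gmax aY) (subdivide x)))).
  apply: homotopic_sym.
  exact: (homotopic_compl (erealize R F) (realize_max_subdivide aY)).
apply: (@homotopic_trans _ _ _ _ _ _ _
  (fun x => realize G (realize (gmin aY) (subdivide x)))); last first.
  exact: (homotopic_compl (erealize R G) (realize_min_subdivide aY)).
apply: (@homotopic_contiguous _ _ _ _ _ _ _ _
  (ecomp (erealize R F) (ecomp (erealize R (gmax aY)) S))
  (ecomp (erealize R G) (ecomp (erealize R (gmin aY)) S))) => x /=.
rewrite !supp_realize -!imset_comp.
have /chainsP[/set0Pn[c0 c0x] cc] := supp_simplex (subdivide x).
exists ([set F (chain_max c) | c in supp (subdivide x)] :|: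
        [set G (chain_min c) | c in supp (subdivide x)]); last first.
  by rewrite subsetUl subsetUr.
apply/chainsP; split.
  by apply/set0Pn; exists (F (chain_max c0)); apply/setUP; left; exact: imset_f.
move=> _ _ /setUP[]/imsetP[c cx ->] /setUP[]/imsetP[c' cx' ->].
- by case/orP: (cc c c' cx cx') => h; apply/orP; [right|left];
    apply: Fa; exact: chain_max_homo.
- by apply/orP; left; apply: FGc; exact: cc.
- by apply/orP; right; apply: FGc; exact: cc.
- by case/orP: (cc c c' cx cx') => h; apply/orP; [left|right];
    apply: Ga; exact: chain_min_anti.
Qed.

End PosetHomotopies.

(** * A criterion for an antitone map to be a homotopy equivalence *)

Section AntitoneEquivalence.
Variables (R : realType) (gT : finGroupType).
Variables (d d' : Order.disp_t) (M : finPOrderType d) (P : finPOrderType d').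
Variables (aM : poset_action gT M) (aP : poset_action gT P).
Local Notation ract := (realization_action R).
Local Notation oM := (order_complex_action aM).
Local Notation oP := (order_complex_action aP).
Variables (Phi : M -> P) (K : Chain P -> M).
Hypothesis Phi_anti : {homo Phi : x y / (x <= y)%O >-> (y <= x)%O}.
Hypothesis Phi_act : forall x k, Phi (aM x k) = aP (Phi x) k.
Hypothesis K_homo : {homo K : x y / (x <= y)%O}.
Hypothesis K_act : forall c k, K (chain_action aP c k) = aM (K c) k.
Hypothesis PhiK : forall c, Phi (K c) \in fset_of c.
Hypothesis K_join : forall x (c : Chain P),
  (forall p, p \in fset_of c -> exists2 y, (x <= y)%O & p = Phi y) ->
  exists j, forall z, (j <= z)%O = (x <= z)%O && (K c <= z)%O.

Let gPhi : gsimplicial_map oM oP :=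
  gorder_map (anti_comparable Phi_anti) Phi_act.

Let gK : gsimplicial_map (order_complex_action (chain_action aP)) oM :=
  gorder_map (homo_comparable K_homo) K_act.

(** Chains of chains make [A] and [B] both antitone: enlarging [D] enlarges its largest chain, whose
    minimum drops, and shrinks its smallest chain, on which [K] is monotone. *)
Let A (D : Chain (Chain M)) : M := chain_min (chain_max D).
Let B (D : Chain (Chain M)) : M := K (face_map gPhi (chain_min D)).

Let A_anti : {homo A : x y / (x <= y)%O >-> (y <= x)%O}.
Proof. by move=> D D' DD'; exact/chain_min_anti/chain_max_homo. Qed.

Let B_anti : {homo B : x y / (x <= y)%O >-> (y <= x)%O}.
Proof. by move=> D D' DD'; exact/K_homo/face_map_le/chain_min_anti. Qed.

Let A_act D k : A (chain_action (chain_action aM) D k) = aM (A D) k.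
Proof. by rewrite /A chain_max_act chain_min_act. Qed.

Let B_act D k : B (chain_action (chain_action aM) D k) = aM (B D) k.
Proof. by rewrite /B chain_min_act (face_map_act gPhi) K_act. Qed.

(** Members of the smallest chain of [D] belong to the largest one, hence lie above [A D]; this is
    the condition under which [K_join] provides a join. *)
Let E_subproof D : exists j,
  [forall z, (j <= z)%O == (A D <= z)%O && (B D <= z)%O].
Proof.
have [|j jP] := @K_join (A D) (face_map gPhi (chain_min D)).
  move=> _ /imsetP[y yD ->]; exists y => //; apply: chain_min_le.
  by apply: le_chain yD; apply: le_chain_max; exact: chain_min_in.
by exists j; apply/forallP => z; rewrite jP.
Qed.

(** Although chosen, [E D] is determined by its universal property, from which its antitonicity and
    its equivariance follow. *)
Let E D : M := xchoose (E_subproof D).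

Let EP D z : (E D <= z)%O = (A D <= z)%O && (B D <= z)%O.
Proof. by have /forallP/(_ z)/eqP := xchooseP (E_subproof D). Qed.

Let AE D : (A D <= E D)%O.
Proof. by have := EP D (E D); rewrite lexx => /esym/andP[]. Qed.

Let BE D : (B D <= E D)%O.
Proof. by have := EP D (E D); rewrite lexx => /esym/andP[]. Qed.

Let E_anti : {homo E : x y / (x <= y)%O >-> (y <= x)%O}.
Proof.
move=> D D' DD'; rewrite EP (le_trans (A_anti DD') (AE D)).
by rewrite (le_trans (B_anti DD') (BE D)).
Qed.

Let E_act D k : E (chain_action (chain_action aM) D k) = aM (E D) k.
Proof.
have le_act x z : (aM x k <= z)%O = (x <= aM z k^-1%g)%O.
  by rewrite -[RHS](poset_act_le aM _ _ k) actKV.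
apply/le_anti/andP; split; first by rewrite EP A_act B_act !poset_act_le AE BE.
by rewrite le_act EP -!le_act -A_act -B_act AE BE.
Qed.

Let gA := gorder_map (anti_comparable A_anti) A_act.
Let gB := gorder_map (anti_comparable B_anti) B_act.
Let gE := gorder_map (anti_comparable E_anti) E_act.

Let sdM := esubdivide R oM.
Let sd2M := esubdivide R (order_complex_action (chain_action aM)).
Let sdd := ecomp sd2M sdM.

(** Comparing supports replaces a proof that [realize] respects composition. *)
Let realize_same (W : finType) (Y : complex W) (b : simplicial_action gT Y)
  (f g : emap R oM b) : (forall x, supp (f x) = supp (g x)) ->
  homotopic (ract oM) b f g.
Proof. by move=> fg; apply: homotopic_supp => x; rewrite fg. Qed.

Let A_homotopic : homotopic (ract oM) oM (fun x => realize gA (sdd x)) id.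
Proof.
apply: (@homotopic_trans _ _ _ _ _ _ _
  (fun x => realize (gmin aM) (realize (gmax (chain_action aM)) (sdd x)))).
  apply: (@realize_same _ _ _ (ecomp (erealize R gA) sdd)
    (ecomp (erealize R (gmin aM))
      (ecomp (erealize R (gmax (chain_action aM))) sdd))) => x /=.
  by rewrite !supp_realize -imset_comp.
apply: (@homotopic_trans _ _ _ _ _ _ _
  (fun x => realize (gmin aM) (sdM x))); last exact: realize_min_subdivide.
apply: (homotopic_compl (erealize R (gmin aM))).
exact: (homotopic_compr sdM (realize_max_subdivide R (chain_action aM))).
Qed.

Let B_homotopic : homotopic (ract oM) oM (fun x => realize gB (sdd x))
  (fun x => realize gK (realize (gface_map gPhi) (subdivide x))).
Proof.
set h := ecomp (erealize R gK) (erealize R (gface_map gPhi)).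
apply: (@homotopic_trans _ _ _ _ _ _ _
  (fun x => h (realize (gmin (chain_action aM)) (sdd x)))).
  apply: (@realize_same _ _ _ (ecomp (erealize R gB) sdd)
    (ecomp h (ecomp (erealize R (gmin (chain_action aM))) sdd))) => x /=.
  by rewrite !supp_realize -!imset_comp.
apply: (homotopic_compl h).
exact: (homotopic_compr sdM (realize_min_subdivide R (chain_action aM))).
Qed.

Theorem antitone_equiv : homotopy_equiv R oM oP.
Proof.
exists (erealize R gPhi), (ecomp (erealize R gK) (esubdivide R oP)); split.
  (* Naturality moves the subdivision in front of [Phi], after which the composite is homotopic to
     the realization of [B]. *)
  apply: (@homotopic_trans _ _ _ _ _ _ _
    (fun x => realize gK (realize (gface_map gPhi) (subdivide x)))).
    exact: (homotopic_compl (erealize R gK) (subdivide_natural R gPhi)).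
  apply: homotopic_trans (homotopic_sym B_homotopic) _.
  apply: homotopic_trans _ A_homotopic.
  (* [B] and [A] are linked through their common upper bound [E]. *)
  apply: (@homotopic_trans _ _ _ _ _ _ _ (fun x => realize gE (sdd x))).
    exact: (homotopic_compr sdd (antitone_homotopic R (F := gB) (G := gE) B_anti E_anti BE)).
  apply: homotopic_sym.
  exact: (homotopic_compr sdd (antitone_homotopic R (F := gA) (G := gE) A_anti E_anti AE)).
(* [K] followed by [Phi] picks a member of each chain, so the image of [y] stays in the closed
   simplex of [y]. *)
apply: (@homotopic_supp _ _ _ _ _ _ _ _ (ecomp (erealize R gPhi)
  (ecomp (erealize R gK) (esubdivide R oP))) (eid R oP)) => y /=.
rewrite !supp_realize -imset_comp; apply/subsetP => _ /imsetP[c cy ->].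
exact: (subsetP (supp_subdivide_sub cy) _ (PhiK c)).
Qed.

End AntitoneEquivalence.

Lemma order_iso_equiv (R : realType) (gT : finGroupType) d d'
    (M : finPOrderType d) (P : finPOrderType d')
    (aM : poset_action gT M) (aP : poset_action gT P) (F : M -> P) (G : P -> M) :
  {homo F : x y / (x <= y)%O} -> {homo G : x y / (x <= y)%O} ->
  (forall x k, F (aM x k) = aP (F x) k) ->
  cancel F G -> cancel G F ->
  homotopy_equiv R (order_complex_action aM) (order_complex_action aP).
Proof.
move=> Fh Gh FE FK GK.
have GE x k : G (aP x k) = aM (G x) k by rewrite -{1}(GK x) -FE FK.
pose gF := gorder_map (homo_comparable Fh) FE.
pose gG := gorder_map (homo_comparable Gh) GE.
exists (erealize R gF), (erealize R gG); split.
  apply: (@homotopic_supp _ _ _ _ _ _ _ _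
    (ecomp (erealize R gG) (erealize R gF)) (eid R _)) => x /=.
  rewrite !supp_realize -imset_comp (eq_imset _ (FK : G \o F =1 id)).
  by rewrite imset_id.
apply: (@homotopic_supp _ _ _ _ _ _ _ _
  (ecomp (erealize R gF) (erealize R gG)) (eid R _)) => x /=.
rewrite !supp_realize -imset_comp (eq_imset _ (GK : F \o G =1 id)).
by rewrite imset_id.
Qed.

(** * Tuples of mutually comparable sets *)

Section Multihom.
Variables (n : nat) (G : graph).
Local Notation Kn := (complete_graph n).

Lemma multihomP (al : {ffun Kn -> {set G}}) :
  reflect ((forall i, al i != set0) /\
           (forall i j x y, i != j -> x \in al i -> y \in al j -> adj x y))
    (is_multihom al).
Proof.
apply: (iffP andP) => -[al0 aladj]; split.
- exact/forallP.
- move=> i j x y ij xi yj.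
  have /forallP/(_ j)/implyP/(_ ij)/forall_inP/(_ x xi) := forallP aladj i.
  by move=> /forall_inP; apply.
- exact/forallP.
- apply/forallP => i; apply/forallP => j; apply/implyP => ij.
  by apply/forall_inP => x xi; apply/forall_inP => y; exact: aladj ij xi.
Qed.

Lemma hom_neq0 (al : Hom Kn G) (i : Kn) : exists x, x \in hom_val al i.
Proof. by have /multihomP[al0 _] := hom_multihom al; exact/set0Pn. Qed.

Lemma hom_adj (al : Hom Kn G) (i j : Kn) x y :
  i != j -> x \in hom_val al i -> y \in hom_val al j -> adj x y.
Proof. by have /multihomP[_] := hom_multihom al; apply. Qed.

Lemma hom_leP (al be : Hom Kn G) :
  reflect (forall i, hom_val al i \subset hom_val be i) (al <= be)%O.
Proof. exact: forallP. Qed.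

End Multihom.

Fact comparable_symmetric d (P : finPOrderType d) :
  symmetric (fun x y : P => (x >=< y)%O).
Proof. by move=> x y; rewrite comparable_sym. Qed.

(** This graph is reflexive, so different colours of a multihomomorphism from [complete_graph n] may
    share elements, and elements of one colour are not compared with each other. *)
Definition comparability_graph d (P : finPOrderType d) : graph :=
  Graph (@comparable_symmetric d P).

Lemma hom_comparable n d (P : finPOrderType d)
    (be : Hom (complete_graph n) (comparability_graph P)) (i j : 'I_n) (x y : P) :
  i != j -> x \in hom_val be i -> y \in hom_val be j -> (x >=< y)%O.
Proof. exact: (@hom_adj n (comparability_graph P)). Qed.

Section ConjugationAction.
Variables (n : nat) (d : Order.disp_t) (P : finPOrderType d).
Variable a : poset_action 'S_n P.
Local Notation M := (Hom (complete_graph n) (comparability_graph P)).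

Lemma poset_act_comparable x y k : (a x k >=< a y k)%O = (x >=< y)%O.
Proof. by rewrite /Order.comparable !poset_act_le. Qed.

Fact conj_act_subproof (be : M) (k : 'S_n) :
  is_multihom (T := complete_graph n) (G := comparability_graph P)
    [ffun i => [set a x k | x in hom_val be (complete_ract i k)]].
Proof.
apply/multihomP; split=> [i|i j y y' ij]; rewrite !ffunE.
  have [x xi] := hom_neq0 be (complete_ract i k).
  by apply/set0Pn; exists (a x k); exact: imset_f.
move=> /imsetP[x xi ->] /imsetP[z zj ->]; rewrite /adj /= poset_act_comparable.
by apply: hom_adj xi zj; rewrite /complete_ract (inj_eq perm_inj).
Qed.

Definition conj_act_fun (be : M) (k : 'S_n) : M := MkHom (conj_act_subproof be k).

Lemma conj_actE (be : M) k i :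
  hom_val (conj_act_fun be k) i = [set a x k | x in hom_val be (complete_ract i k)].
Proof. by rewrite ffunE. Qed.

Fact conj_act1 : conj_act_fun^~ 1%g =1 id.
Proof.
move=> be; apply: val_inj; apply/ffunP => i; rewrite [LHS]conj_actE.
by rewrite (eq_imset _ (act1 a)) imset_id /complete_ract invg1 perm1.
Qed.

Fact conj_actM be : act_morph conj_act_fun be.
Proof.
move=> g h; apply: val_inj; apply/ffunP => i; rewrite [LHS]conj_actE.
rewrite [RHS]conj_actE conj_actE /complete_ract invMg permM -imset_comp.
by apply: eq_imset => x /=; rewrite actM.
Qed.

Fact conj_act_homo k :
  {homo (TotalAction conj_act1 conj_actM)^~ k : x y / (x <= y)%O}.
Proof.
move=> be be' /hom_leP le; apply/hom_leP => i /=.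
by rewrite !conj_actE; apply: imsetS; exact: le.
Qed.

Definition conj_action : poset_action 'S_n M := PosetAction conj_act_homo.

End ConjugationAction.

(** * The core of a tuple and its homotopy inverse *)

Section TupleEquivalence.
Variables (R : realType) (n : nat) (hn : (2 <= n)%N).
Variables (d : Order.disp_t) (Q : finPOrderType d) (aQ : poset_action 'S_n Q).
Local Notation P := (Chain Q).
Local Notation aP := (chain_action aQ).
Local Notation M := (Hom (complete_graph n) (comparability_graph P)).
Local Notation aM := (conj_action aP).
Implicit Types be : M.

(* The union x :|: y is the larger of the two comparable chains x and y. *)
Definition core_set be : {set Q} := [set q |
  [forall i : 'I_n, forall j : 'I_n, (i != j) ==>
    [forall x in hom_val be i, forall y in hom_val be j,
      q \in fset_of x :|: fset_of y]]].

Lemma core_setP be q : reflect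
  (forall (i j : 'I_n) (x y : P), i != j -> x \in hom_val be i ->
     y \in hom_val be j -> (q \in fset_of x) || (q \in fset_of y))
  (q \in core_set be).
Proof.
rewrite inE; apply: (iffP forallP) => [qP i j x y ij xi yj|qP i].
  have /forallP/(_ j)/implyP/(_ ij)/forall_inP/(_ x xi) := qP i.
  by move=> /forall_inP/(_ y yj); rewrite in_setU.
apply/forallP => j; apply/implyP => ij; apply/forall_inP => x xi.
by apply/forall_inP => y yj; rewrite in_setU; exact: qP ij xi yj.
Qed.

(* A smallest member c of the tuple lies in every union x :|: y: one of x, y has
   a colour different from that of c, and then contains c. *)
Lemma core_set_neq0 be : core_set be != set0.
Proof.
pose i0 : 'I_n := Ordinal (ltnW hn).
have [x0 x0i] := hom_neq0 be i0.
have [[k c] /= ck cmin] := @arg_minnP _ (i0, x0)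
  (fun p : 'I_n * P => p.2 \in hom_val be p.1) (fun p => #|fset_of p.2|) x0i.
have sub i x : k != i -> x \in hom_val be i -> fset_of c \subset fset_of x.
  move=> ki xi; have /orP[//|xc] : (c >=< x)%O := hom_comparable ki ck xi.
  suff /eqP-> : fset_of x == fset_of c by [].
  by rewrite eqEcard; apply/andP; split; [exact: xc|exact: (cmin (i, x))].
have [q qc] := chain_neq0 c; apply/set0Pn; exists q; apply/core_setP.
move=> i j x y ij xi yj; apply/orP.
have [ki|ki] := eqVneq k i; last by left; exact: (subsetP (sub i x ki xi)).
by right; apply: (subsetP (sub j y _ yj)) => //; rewrite ki.
Qed.

Lemma core_set_sub be (i j : 'I_n) x y : i != j -> x \in hom_val be i ->
  y \in hom_val be j -> fset_of y \subset fset_of x ->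
  core_set be \subset fset_of x.
Proof.
move=> ij xi yj yx; apply/subsetP => q /core_setP/(_ i j x y ij xi yj).
by case/orP => // /(subsetP yx).
Qed.

(** Since [n] is at least 2 there are two colours to draw from, and the core lies in the larger of
    two comparable chains. *)
Fact core_simplex be : core_set be \in simplices (order_complex Q).
Proof.
pose i0 : 'I_n := Ordinal (ltnW hn); pose i1 : 'I_n := Ordinal hn.
have [x xi] := hom_neq0 be i0; have [y yj] := hom_neq0 be i1.
have /orP[xy|yx] : (x >=< y)%O := hom_comparable (isT : i0 != i1) xi yj.
  apply: simplex_sub (face_simplex y) _ (core_set_neq0 be).
  exact: core_set_sub (isT : i1 != i0) yj xi xy.
apply: simplex_sub (face_simplex x) _ (core_set_neq0 be).
exact: core_set_sub (isT : i0 != i1) xi yj yx.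
Qed.

Definition core be : P := Face (core_simplex be).

(** If [x] has an element [q] outside the core, some union of two chains of different colours misses
    [q]. One of the two, [y], has a colour other than [i]; it is comparable to [x] and misses [q],
    so it lies in [x], and the core lies in the union of [x] and [y], which is [x]. *)
Lemma core_comparable be i x : x \in hom_val be i -> (core be >=< x)%O.
Proof.
move=> xi; apply/orP; have [xs|/subsetPn[q qx]] :=
  boolP (fset_of x \subset core_set be); [by right|move=> qc; left].
have [j [y [ij yj qy]]] : exists j y,
    [/\ i != j, y \in hom_val be j & q \notin fset_of y].
  apply: contrapT => none; case/negP: qc; apply/core_setP => j k y z jk yj zk.
  apply: contraT; rewrite negb_or => /andP[qy qz]; exfalso; apply: none.
  have [ij|ij] := eqVneq i j; last by exists j, y.
  by exists k, z; rewrite ij.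
have /orP[xy|yx] : (x >=< y)%O := hom_comparable ij xi yj.
  by rewrite (subsetP (xy : fset_of x \subset _) q qx) in qy.
exact: core_set_sub ij xi yj yx.
Qed.

Lemma core_anti : {homo core : x y / (x <= y)%O >-> (y <= x)%O}.
Proof.
move=> be be' /hom_leP le; apply/subsetP => q /core_setP qP; apply/core_setP.
move=> i j x y ij xi yj.
by apply: (qP i j x y ij); [exact: (subsetP (le i))|exact: (subsetP (le j))].
Qed.

Lemma core_act be k : core (aM be k) = aP (core be) k.
Proof.
(* One inequality for all tuples and permutations suffices: the other is its instance at [aM be k]
   and the inverse of [k]. *)
have le be' k' : (core (aM be' k') <= aP (core be') k')%O.
  apply/subsetP => q /core_setP qP; apply/imsetP.
  exists (aQ q k'^-1%g); last by rewrite actKV.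
  apply/core_setP => i j x y ij xi yj.
  have mem (z : P) : (q \in fset_of (aP z k')) -> aQ q k'^-1%g \in fset_of z.
    by case/imsetP => q' q'z ->; rewrite actK.
  have conj l z : z \in hom_val be' l -> aP z k' \in hom_val (aM be' k') (k' l).
    by move=> zl; rewrite conj_actE /complete_ract permK; exact: imset_f.
  have kij : k' i != k' j by rewrite (inj_eq perm_inj).
  by have /orP[/mem->|/mem->] := qP _ _ _ _ kij (conj i x xi) (conj j y yj);
    rewrite ?orbT.
apply/le_anti/andP; split; first exact: le.
have := poset_actP aP k (le (aM be k) k^-1%g).
by rewrite actK actKV.
Qed.

Fact const_subproof (c : Chain P) :
  is_multihom (T := complete_graph n) (G := comparability_graph P)
    [ffun=> fset_of c].
Proof.
apply/multihomP; split=> [i|i j x y _]; rewrite !ffunE; first exact: face_neq0.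
exact: chain_comparable.
Qed.

Definition const_hom (c : Chain P) : M := MkHom (const_subproof c).

Lemma const_homE c i : hom_val (const_hom c) i = fset_of c.
Proof. by rewrite ffunE. Qed.

Lemma const_hom_homo : {homo const_hom : x y / (x <= y)%O}.
Proof. by move=> c c' cc'; apply/hom_leP => i; rewrite !const_homE. Qed.

Lemma const_hom_act c k : const_hom (chain_action aP c k) = aM (const_hom c) k.
Proof.
apply: val_inj; apply/ffunP => i.
by rewrite [LHS]const_homE [RHS]conj_actE const_homE.
Qed.

(** Every union of two members of [c] contains the smallest member, and taking that member in both
    colours attains it. *)
Lemma core_const c : core (const_hom c) \in fset_of c.
Proof.
suff -> : core (const_hom c) = chain_min c by exact: chain_min_in.
pose i0 : 'I_n := Ordinal (ltnW hn); pose i1 : 'I_n := Ordinal hn.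
apply/le_anti/andP; split.
  by apply: (@core_set_sub _ i0 i1) => //; rewrite const_homE chain_min_in.
apply/subsetP => q qc; apply/core_setP => i j x y _; rewrite !const_homE => xc _.
by rewrite (subsetP (chain_min_le xc : fset_of _ \subset _) q qc).
Qed.

(** The join is the colourwise union with [c]. It is admissible because a member of [c] is the core
    of a tuple above [be], hence comparable to all elements of [be]. *)
Lemma const_join be (c : Chain P) :
  (forall p, p \in fset_of c -> exists2 be', (be <= be')%O & p = core be') ->
  exists j, forall z, (j <= z)%O = (be <= z)%O && (const_hom c <= z)%O.
Proof.
move=> cP.
have jP : is_multihom (T := complete_graph n) (G := comparability_graph P)
    [ffun i => hom_val be i :|: fset_of c].
  have becP i x y : x \in hom_val be i -> y \in fset_of c -> (y >=< x)%O.
    move=> xi yc; have [be' /hom_leP le ->] := cP y yc.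
    by apply: (@core_comparable be' i); exact: (subsetP (le i)).
  apply/multihomP; split=> [i|i j x y ij]; rewrite !ffunE.
    have [x xi] := hom_neq0 be i.
    by apply/set0Pn; exists x; rewrite in_setU xi.
  rewrite !in_setU => /orP[xi|xc] /orP[yj|yc].
  - exact: hom_comparable ij xi yj.
  - by rewrite adj_sym; exact: becP xi yc.
  - exact: becP yj xc.
  - exact: chain_comparable xc yc.
exists (MkHom jP) => z; apply/hom_leP/andP => [le|[/hom_leP le /hom_leP le'] i].
  split; apply/hom_leP => i; have := le i; rewrite /= ffunE subUset => /andP[] //.
  by rewrite const_homE.
by rewrite /= ffunE subUset le -(const_homE c i) le'.
Qed.

Theorem tuple_equiv :
  homotopy_equiv R (order_complex_action aM) (order_complex_action aP).
Proof.
exact: antitone_equiv core_anti core_act const_hom_homo const_hom_act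
  core_const const_join.
Qed.

End TupleEquivalence.

(** * Lifting multihomomorphisms along the orbit map *)

Section Walks.
Variable gT : finGroupType.

(* One subdivision halves the length of a walk: up to monotone steps a walk in
   Chain Q alternates, and its peaks make elements of the valleys comparable. *)
Lemma two_step d (Q : finPOrderType d) (c e f : Chain Q) :
  (c >=< e)%O -> (e >=< f)%O ->
  {in fset_of c & fset_of f, forall x y, (x >=< y)%O} \/
  exists2 x, x \in fset_of c & x \in fset_of f.
Proof.
case/orP => ce /orP[ef|fe].
- by have [x xc] := chain_neq0 c; right; exists x => //; exact: le_chain ef (le_chain ce xc).
- left=> x y xc yf.
  exact: (chain_comparable (le_chain ce xc) (le_chain fe yf)).
- by have [x xe] := chain_neq0 e; right; exists x; exact: le_chain xe.
- by have [x xf] := chain_neq0 f; right; exists x => //; exact: le_chain ce (le_chain fe xf).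
Qed.

Variables (d : Order.disp_t) (F : finPOrderType d) (a : poset_action gT F).
Hypothesis F_free : forall (x : F) g, (x >=< a x g)%O -> g = 1%g.

(** Either every element of [p] is comparable to every element of its translate, or [p] contains
    some [y] together with its translate by [g]. Both give an element comparable to its own
    translate. *)
Lemma chain_walk2 (p q : Chain F) g :
  (p >=< q)%O -> (q >=< chain_action a p g)%O -> g = 1%g.
Proof.
move=> pq qp; case: (two_step pq qp) => [cc|[x xp]].
  have [x xp] := chain_neq0 p; apply: (F_free (x := x)).
  by apply: cc => //; exact: imset_f.
case/imsetP => y yp xy; apply: (F_free (x := y)); rewrite -xy.
exact: chain_comparable yp xp.
Qed.

(** Each half of the walk, between [p1] and [p3] and back to the translate of [p1], becomes one
    comparability or one common element a level down, which leaves a walk for [chain_walk2]. *)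
Lemma chain_walk4 (p1 p2 p3 p4 : Chain (Chain F)) g :
  (p1 >=< p2)%O -> (p2 >=< p3)%O -> (p3 >=< p4)%O ->
  (p4 >=< chain_action (chain_action a) p1 g)%O -> g = 1%g.
Proof.
move=> p12 p23 p34 p41.
case: (two_step p12 p23) => [c13|[q q1 q3]];
  case: (two_step p34 p41) => [c31|[r r3 /imsetP[r' r'1 r'r]]].
- have [q1 q1p] := chain_neq0 p1; have [q3 q3p] := chain_neq0 p3.
  apply: (chain_walk2 (p := q1) (q := q3)); first exact: c13.
  by apply: c31 => //; exact: imset_f.
- apply: (chain_walk2 (p := r') (q := r)); first exact: c13.
  by rewrite -r'r comparablexx.
- apply: (chain_walk2 (p := q) (q := q)); first exact: comparablexx.
  by apply: c31 => //; exact: imset_f.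
- apply: (chain_walk2 (p := r') (q := q)).
    exact: (chain_comparable r'1 q1).
  by rewrite -r'r; exact: (chain_comparable q3 r3).
Qed.

End Walks.

(** * The isomorphism between multihomomorphisms into the orbit graph and tuples *)

Section Lifting.
Variables (n : nat) (d : Order.disp_t) (P : finPOrderType d).
Variable a : poset_action 'S_n P.
Hypothesis walk4 : forall (p1 p2 p3 p4 : P) g,
  (p1 >=< p2)%O -> (p2 >=< p3)%O -> (p3 >=< p4)%O -> (p4 >=< a p1 g)%O -> g = 1%g.

Local Notation G := (@balanced_product 'S_n (complete_graph n)
  (atom_graph (Chain P)) (@complete_ract n) (atom_action (chain_action a))).
Local Notation M := (Hom (complete_graph n) (comparability_graph P)).
Local Notation HG := (Hom (complete_graph n) G).

(** The atoms of [Chain P] are the singletons, and two of them have an upper bound exactly when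
    their points are comparable; the outermost [Chain] thus turns [P] into its comparability
    graph. *)
Definition point_chain (p : P) : Chain P :=
  @Face P (order_complex P) [set p] (chains_vertex p).

Fact point_atom_subproof (p : P) :
  [forall y : Chain P, (y <= point_chain p)%O ==> (y == point_chain p)].
Proof.
apply/forallP => y; apply/implyP => yp; apply/eqP/val_inj => /=.
apply/eqP; have : fset_of y \subset [set p] := yp.
by rewrite subset1 (negbTE (face_neq0 y)) orbF.
Qed.

Definition point_atom (p : P) : atom_graph (Chain P) := Atom (point_atom_subproof p).

Lemma point_atomP (x : atom_graph (Chain P)) : exists p, x = point_atom p.
Proof.
have [p px] := chain_neq0 (atom_val x); exists p; apply: val_inj => /=.
apply/esym/eqP; have /forallP/(_ (point_chain p))/implyP := atom_min x.
by apply; rewrite /Order.le /= /face_le /= sub1set.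
Qed.

Lemma point_atom_inj : injective point_atom.
Proof.
move=> p q /(congr1 (fun x : atom (Chain P) => fset_of (atom_val x))) /=.
exact: set1_inj.
Qed.

Lemma point_atom_adj p q : adj (point_atom p) (point_atom q) = (p >=< q)%O.
Proof.
apply/existsP/idP => [[c /andP[pc qc]]|pq].
  apply: (@chain_comparable _ _ c).
    by move: pc; rewrite /Order.le /= /face_le /= sub1set.
  by move: qc; rewrite /Order.le /= /face_le /= sub1set.
have pqc : [set p; q] \in simplices (order_complex P).
  apply/chainsP; split=> [|x y].
    by apply/set0Pn; exists p; rewrite set21.
  by case/set2P=> -> /set2P[] ->; rewrite ?comparablexx // comparable_sym.
exists (Face pqc); rewrite /Order.le /= /face_le /= !sub1set.
by rewrite set21 set22.
Qed.

Lemma point_atom_act p g :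
  atom_action (chain_action a) (point_atom p) g = point_atom (a p g).
Proof. by apply: val_inj; apply: val_inj; rewrite /= imset_set1. Qed.

Local Notation equiv := (@balanced_equiv 'S_n (complete_graph n)
  (atom_graph (Chain P)) (@complete_ract n) (atom_action (chain_action a))).
Local Notation class := (@balanced_class 'S_n (complete_graph n)
  (atom_graph (Chain P)) (@complete_ract n) (atom_action (chain_action a))).

(** As the right action on colours is by inverses, a generating step moves both coordinates by the
    same [g]. Such moves compose and invert within the group, so the closure is the orbit relation
    of the diagonal action. *)
Lemma balanced_equivP (i j : 'I_n) (x y : atom_graph (Chain P)) :
  reflect (exists2 g : 'S_n, j = g i & y = atom_action (chain_action a) x g)
    (equiv (i, x) (j, y)).
Proof.
set act := atom_action (chain_action a).
have stepP u v : reflect (exists2 g : 'S_n, v.1 = g u.1 & v.2 = act u.2 g)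
    (@balanced_step 'S_n (complete_graph n) (atom_graph (Chain P))
      (@complete_ract n) act u v).
  apply: (iffP existsP) => [[t /existsP[h /existsP[g]]]|[g vu1 vu2]].
    case/andP => /eqP-> /eqP->; exists g => //=.
    by rewrite /complete_ract permKV.
  exists v.1; apply/existsP; exists u.2; apply/existsP; exists g.
  rewrite -vu2 /complete_ract vu1 permK -!surjective_pairing eqxx /=.
  by rewrite -vu1 -surjective_pairing.
apply: (iffP connectP) => [[s]|[g ji yx]]; last first.
  exists [:: (j, y)] => //=; rewrite andbT; apply/orP; left.
  by apply/stepP; exists g.
elim: s i x => [|[k z] s IHs] i x /=.
  by move=> _ [-> ->]; exists 1%g; rewrite ?perm1 //; exact/esym/(act1 act).
case/andP => step zs /(IHs _ _ zs)[g -> ->].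
case/orP: step => /stepP[h /= -> ->].
  by exists (h * g)%g; [rewrite permM|exact/esym/(actM act)].
exists (h^-1 * g)%g; first by rewrite permM permK.
by rewrite -[RHS]/(act (act z h) (h^-1 * g)%g) actM actK.
Qed.

Fact orbit_vertex_subproof (u : complete_graph n * atom_graph (Chain P)) :
  class u \in [set class v |
    v in [set: complete_graph n * atom_graph (Chain P)]].
Proof. by apply: imset_f; rewrite inE. Qed.

Definition orbit_vertex (i : 'I_n) (p : P) : G :=
  BalancedVertex (orbit_vertex_subproof (i, point_atom p)).

Lemma in_orbit_vertex i p (j : 'I_n) (x : atom_graph (Chain P)) :
  reflect (exists2 g : 'S_n, j = g i & x = point_atom (a p g))
    ((j, x) \in bvset (orbit_vertex i p)).
Proof.
rewrite inE; apply: (iffP (balanced_equivP _ _ _ _)) => -[g ji xp];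
  by exists g; rewrite // xp point_atom_act.
Qed.

Lemma orbit_vertexP (v : G) : exists i p, v = orbit_vertex i p.
Proof.
case: v => B vB; have /imsetP[[i x] _ BE] := vB.
have [p xp] := point_atomP x.
by exists i, p; apply: val_inj; rewrite /= BE xp.
Qed.

Lemma orbit_vertex_eq i p j q :
  orbit_vertex i p = orbit_vertex j q <->
  exists2 g : 'S_n, j = g i & q = a p g.
Proof.
split=> [pq|[g -> ->]].
  have : (j, point_atom q) \in bvset (orbit_vertex j q).
    by apply/in_orbit_vertex; exists 1%g; rewrite ?perm1 ?act1.
  by rewrite -pq => /in_orbit_vertex[g ji /point_atom_inj qp]; exists g.
apply: val_inj => /=; apply/setP => -[k x].
apply/in_orbit_vertex/in_orbit_vertex => -[h -> ->].
  by exists (g^-1 * h)%g; rewrite ?permM ?permK // actM actK.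
by exists (g * h)%g; rewrite ?permM // actM.
Qed.

(** Moving an adjacent pair of representatives simultaneously brings the first one back to [(i, p)],
    so only the second needs a group element. *)
Lemma orbit_vertex_adj i p j q :
  adj (orbit_vertex i p) (orbit_vertex j q) <->
  exists2 g : 'S_n, i != g j & (p >=< a q g)%O.
Proof.
split=> [/exists_inP[[k x] /in_orbit_vertex[g -> ->]]|[g ij pq]].
  case/exists_inP=> -[l y] /in_orbit_vertex[h -> ->].
  rewrite point_atom_adj /adj /= => /andP[ij pq]; exists (h * g^-1)%g.
    by apply: contra ij => /eqP->; rewrite permM permKV.
  by rewrite -(poset_act_comparable a _ _ g) actM actKV.
apply/exists_inP; exists (i, point_atom p).
  by apply/in_orbit_vertex; exists 1%g; rewrite ?perm1 ?act1.
apply/exists_inP; exists (g j, point_atom (a q g)).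
  by apply/in_orbit_vertex; exists g.
by rewrite point_atom_adj /adj /= ij.
Qed.

(** A loop would make some [p] comparable to a translate of itself by a [g] that moves a colour,
    against rigidity. *)
Lemma balanced_loopless : loopless G.
Proof.
move=> v; apply/negP; have [i [p ->]] := orbit_vertexP v.
case/orbit_vertex_adj => g ig pg; move: ig.
have pp := comparablexx p.
by rewrite (walk4 pp pp pp pg) perm1 eqxx.
Qed.

(* Requiring (j, f j), rather than any (tau j, f j) with tau a permutation, to
   represent a vertex in al j makes the lift canonical, hence equivariant. *)
Definition is_lift (al : HG) (f : {ffun 'I_n -> P}) :=
  [forall j, orbit_vertex j (f j) \in hom_val al j] &&
  [forall j, forall k, (f j >=< f k)%O].

Implicit Types (al : HG) (be : M) (f : {ffun 'I_n -> P}).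

Lemma is_liftP al f :
  reflect ((forall j, orbit_vertex j (f j) \in hom_val al j) /\
           (forall j k, (f j >=< f k)%O)) (is_lift al f).
Proof.
apply: (iffP andP) => -[/forallP al_f f_f]; split=> //.
  by move=> j k; have /forallP := forallP f_f j; apply.
by apply/forallP => j; apply/forallP.
Qed.

Lemma lift_exists al (i : 'I_n) v : v \in hom_val al i ->
  exists2 f, is_lift al f & orbit_vertex i (f i) = v.
Proof.
move=> vi; have [ti [ci vE]] := orbit_vertexP v.
(* In each colour a vertex is chosen, with a representative whose second coordinate is comparable to
   that of the fixed representative of [v]. *)
have rep (j : 'I_n) : exists tc : 'I_n * P,
    [/\ orbit_vertex tc.1 tc.2 \in hom_val al j, (tc.2 >=< ci)%O &
        j = i -> orbit_vertex tc.1 tc.2 = v].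
  have [->|ji] := eqVneq j i.
    by exists (ti, ci); rewrite -vE; split; rewrite ?comparablexx.
  have [u uj] := hom_neq0 al j; have [t [c uE]] := orbit_vertexP u.
  have ij : i != j by rewrite eq_sym.
  have := hom_adj ij vi uj; rewrite vE uE => /orbit_vertex_adj[g _ cg].
  exists (g t, a c g); split=> [||jE]; last by rewrite jE eqxx in ji.
    suff <- : u = orbit_vertex (g t) (a c g) by [].
    by rewrite uE; apply/orbit_vertex_eq; exists g.
  by rewrite comparable_sym.
have [tc tcP] := fin_all_exists rep.
(* Adjacency of the two vertices closes a walk through [ci], so rigidity gives [g = 1]: the chosen
   representatives are themselves adjacent. *)
have cross j k : j != k -> (tc j).1 != (tc k).1 /\ ((tc j).2 >=< (tc k).2)%O.
  move=> jk; have [[vj cj _] [vk ck _]] := (tcP j, tcP k).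
  have /orbit_vertex_adj[g tg cg] := hom_adj jk vj vk.
  have g1 : g = 1%g.
    by apply: (walk4 ck _ (comparablexx _) cg); rewrite comparable_sym.
  by move: tg cg; rewrite g1 perm1 act1.
have t_inj : injective (fun j => (tc j).1).
  move=> j k tjk; apply/eqP; apply: contraT => /cross[].
  by rewrite tjk eqxx.
(* Acting by the inverse of the permutation of first coordinates makes the representative in colour
   [j] have first coordinate [j]. *)
pose tau := perm t_inj; pose f := [ffun j => a (tc j).2 tau^-1%g].
have fE j : orbit_vertex j (f j) = orbit_vertex (tc j).1 (tc j).2.
  apply/orbit_vertex_eq; exists tau; first by rewrite permE.
  by rewrite ffunE actKV.
exists f; last by rewrite fE; case: (tcP i) => _ _; apply.
apply/is_liftP; split=> [j|j k]; first by rewrite fE; case: (tcP j).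
rewrite !ffunE poset_act_comparable.
by have [->|/cross[]] := eqVneq j k; rewrite ?comparablexx.
Qed.

(** Adjacency gives [f i] comparable to the translate of [f' j] by some [g]. If [g] moved [l],
    adjacency of [f (g l)] and [f' l] in colours [g l] and [l] would give an [h] with [h l]
    different from [g l], while a walk of length four forces [g = h]. *)
Lemma lift_cross al f f' (i j : 'I_n) :
  is_lift al f -> is_lift al f' -> i != j -> (f i >=< f' j)%O.
Proof.
case/is_liftP => fal ff /is_liftP[fal' ff'] ij.
have /orbit_vertex_adj[g _ fg] := hom_adj ij (fal i) (fal' j).
suff g1 : g = 1%g by move: fg; rewrite g1 act1.
apply/permP => l; rewrite perm1; apply/eqP; apply: contraT => gl.
have /orbit_vertex_adj[h glh fh] := hom_adj gl (fal (g l)) (fal' l).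
suff gh : g = h by rewrite gh eqxx in glh.
apply/eqP; rewrite eq_mulVg1; apply/eqP.
apply: (walk4 (p1 := a (f' l) g) (p2 := a (f' j) g) (p3 := f i) (p4 := f (g l))).
- by rewrite poset_act_comparable.
- by rewrite comparable_sym.
- exact: ff.
- by rewrite -actM mulKVg.
Qed.

Fact lift_hom_subproof (al : HG) :
  is_multihom (T := complete_graph n) (G := comparability_graph P)
    [ffun i => [set p | [exists f, is_lift al f && (f i == p)]]].
Proof.
apply/multihomP; split=> [i|i j x y ij]; rewrite !ffunE.
  have [v vi] := hom_neq0 al i; have [f alf _] := lift_exists vi.
  by apply/set0Pn; exists (f i); rewrite inE; apply/existsP; exists f; rewrite alf /=.
rewrite !inE => /existsP[f /andP[alf /eqP<-]] /existsP[f' /andP[alf' /eqP<-]].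
exact: lift_cross alf alf' ij.
Qed.

Definition lift_hom al : M := MkHom (lift_hom_subproof al).

Lemma lift_homP al i p :
  reflect (exists2 f, is_lift al f & f i = p) (p \in hom_val (lift_hom al) i).
Proof.
rewrite /= ffunE inE; apply: (iffP existsP) => -[f].
  by case/andP => alf /eqP; exists f.
by move=> alf <-; exists f; rewrite alf eqxx.
Qed.

Fact orbit_hom_subproof (be : M) :
  is_multihom (T := complete_graph n) (G := G)
    [ffun i => [set orbit_vertex i p | p in hom_val be i]].
Proof.
apply/multihomP; split=> [i|i j x y ij]; rewrite !ffunE.
  have [p pi] := hom_neq0 be i.
  by apply/set0Pn; exists (orbit_vertex i p); exact: imset_f.
case/imsetP => p pi -> /imsetP[q qj ->]; apply/orbit_vertex_adj.
by exists 1%g; rewrite ?perm1 ?act1 //; exact: hom_comparable ij pi qj.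
Qed.

Definition orbit_hom be : HG := MkHom (orbit_hom_subproof be).

Lemma orbit_homE be i :
  hom_val (orbit_hom be) i = [set orbit_vertex i p | p in hom_val be i].
Proof. by rewrite ffunE. Qed.

Lemma lift_homK : cancel lift_hom orbit_hom.
Proof.
move=> al; apply: val_inj; apply/ffunP => i; rewrite [LHS]orbit_homE.
apply/setP => v; apply/imsetP/idP => [[p /lift_homP[f /is_liftP[fal _] <-] ->]|vi].
  exact: fal.
have [f alf fv] := lift_exists vi.
by exists (f i) => //; apply/lift_homP; exists f.
Qed.

Lemma orbit_homK : cancel orbit_hom lift_hom.
Proof.
move=> be; apply: val_inj; apply/ffunP => i; apply/setP => p.
apply/lift_homP/idP => [[f /is_liftP[fal ff] <-]|pi].
  have rep (j : 'I_n) : exists cg : P * 'S_n,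
      [/\ cg.1 \in hom_val be j, cg.2 j = j & f j = a cg.1 cg.2].
    have := fal j; rewrite orbit_homE => /imsetP[c cj /esym/orbit_vertex_eq[g jg fg]].
    by exists (c, g).
  have [cg cgP] := fin_all_exists rep.
  (* Rigidity makes the group elements of different colours agree. As the one for [j] fixes [j],
     their common value fixes every colour and is trivial. *)
  have same j k : j != k -> (cg j).2 = (cg k).2.
    move=> jk; have [[cj _ fj] [ck _ fk]] := (cgP j, cgP k).
    have cjk := hom_comparable jk cj ck.
    apply/eqP; rewrite eq_sym eq_mulgV1; apply/eqP.
    apply: (walk4 (p1 := (cg k).1) (p2 := (cg j).1) _ (comparablexx _) (comparablexx _)).
      by rewrite comparable_sym.
    by rewrite actM -(poset_act_comparable a _ _ (cg j).2) actKV -fj -fk.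
  have [ci _ fi] := cgP i.
  suff g1 : (cg i).2 = 1%g by rewrite fi g1 act1.
  apply/permP => j; rewrite perm1.
  have [<-|ij] := eqVneq i j; first by case: (cgP i).
  by rewrite (same i j ij); case: (cgP j).
have [x xP] := fin_all_exists (fun j : 'I_n => hom_neq0 be j).
(* Any choice of elements in the other colours completes [p] to a lift. *)
pose f := [ffun j : 'I_n => if j == i then p else x j].
have fbe j : f j \in hom_val be j.
  by rewrite ffunE; case: eqVneq => [->|_] //; exact: xP.
exists f; last by rewrite ffunE eqxx.
apply/is_liftP; split=> [j|j k]; first by rewrite orbit_homE; exact: imset_f.
have [->|jk] := eqVneq j k; first exact: comparablexx.
exact: hom_comparable jk (fbe j) (fbe k).
Qed.

Lemma lift_hom_homo : {homo lift_hom : x y / (x <= y)%O}.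
Proof.
move=> al al' /hom_leP le; apply/hom_leP => i; apply/subsetP => p.
case/lift_homP => f /is_liftP[fal ff] <-; apply/lift_homP; exists f => //.
by apply/is_liftP; split=> // j; exact: (subsetP (le j)).
Qed.

Lemma orbit_hom_homo : {homo orbit_hom : x y / (x <= y)%O}.
Proof.
move=> be be' /hom_leP le; apply/hom_leP => i; rewrite !orbit_homE.
by apply: imsetS; exact: le.
Qed.

Lemma orbit_hom_act be k :
  orbit_hom (conj_action a be k) = hom_action n G (orbit_hom be) k.
Proof.
apply: val_inj; apply/ffunP => i; rewrite [LHS]orbit_homE conj_actE.
rewrite /= ffunE [RHS]orbit_homE -imset_comp; apply: eq_imset => p /=.
apply/esym/orbit_vertex_eq; exists k => //.
by rewrite /complete_ract permKV.
Qed.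

Lemma lift_hom_act al k :
  lift_hom (hom_action n G al k) = conj_action a (lift_hom al) k.
Proof. by rewrite -{1}(lift_homK al) -orbit_hom_act orbit_homK. Qed.

Lemma lift_equiv (R : realType) :
  homotopy_equiv R (order_complex_action (hom_action n G))
    (order_complex_action (conj_action a)).
Proof.
exact: order_iso_equiv lift_hom_homo orbit_hom_homo lift_hom_act
  lift_homK orbit_homK.
Qed.

End Lifting.

(** A face comparable to its translate equals it, both having the same cardinality; then [g] fixes
    the barycenter of the face. *)
Lemma face_action_free (R : realType) (gT : finGroupType) (V : finType)
    (X : complex V) (a : simplicial_action gT X) (s : face X) g :
  free_action (realization_action R a) -> (s >=< face_action a s g)%O -> g = 1%g.
Proof.
move=> afree sg.
have card_sg : #|fset_of (face_action a s g)| = #|fset_of s|.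
  exact: card_imset (act_inj a g).
have fixed : face_action a s g = s.
  apply: val_inj; apply/eqP; case/orP: sg => sg; [rewrite eq_sym|];
    by rewrite eqEcard card_sg leqnn andbT; exact: sg.
apply: (afree (barycentric (vertex_point R (order_complex (face X)) s))).
by rewrite -barycentric_equivariant -vertex_point_equivariant [X in vertex_point _ _ X]fixed.
Qed.

Theorem theorem6p12 (R : realType) (n : nat) (hn : (2 <= n)%N)
    (V : finType) (X : complex V) (a : simplicial_action 'S_n X)
    (hfree : free_action (realization_action R a)) :
  let G : graph := @balanced_product 'S_n
      (complete_graph n) (atom_graph (Chain (Chain (Chain (face X)))))
      (@complete_ract n)
      (atom_action (chain_action (chain_action (chain_action
         (face_action a))))) in
  loopless G /\
  equivariant_homotopy_equiv R
    (realization_action R (order_complex_action (hom_action n G)))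
    (realization_action R a).

Proof.
move=> G.
have face_free (s : face X) g : (s >=< face_action a s g)%O -> g = 1%g.
  exact: face_action_free hfree.
split; first exact: balanced_loopless (chain_walk4 face_free).
apply: homotopy_equivW.
apply: homotopy_equiv_trans (lift_equiv (chain_walk4 face_free) R) _.
apply: homotopy_equiv_trans (tuple_equiv R hn _) _.
(* The order complexes of [Chain (Chain (face X))], [Chain (face X)] and [face X] are iterated
   subdivisions of [X], undone one at a time. *)
apply: homotopy_equiv_trans (barycentric_equiv R _) _.
apply: homotopy_equiv_trans (barycentric_equiv R _) _.
exact: barycentric_equiv.
Qed.
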